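(* Let $R>0$, $S_R^{n-1}=\{\mathbf x\in\mathbb R^n:\|\mathbf x\|=R\}$, let $f\in\mathbb R[\mathbf x]$ be a (not necessarily homogeneous) polynomial of degree $k$, and let $f_{\min}=\min_{\mathbf x\in S_R^{n-1}}f(\mathbf x)$. Then the convergence rate of the moment-SOS hierarchy on $\mathcal X=S_R^{n-1}$ is of order $O(1/r^2)$: both $f_{\min}-\mathrm{mlb}(f,\mathcal Q(\mathcal X))_r$ and $f_{\min}-\mathrm{lb}(f,\mathcal Q(\mathcal X))_r$ are $O(1/r^2)$ as $r\to\infty$.
   Context: Notation: $\mathbb N^n_k=\{\alpha\in\mathbb N^n:|\alpha|\le k\}$, $s(n,k)=\binom{n+k}{n}$; $\Sigma[\mathbf x]_{2r}$ = sums of squares of degree $\le2r$. The sphere $\mathcal X=S_R^{n-1}$ is described by the single equation $R^2-\|\mathbf x\|^2=0$. For $y=(y_\alpha)_{\alpha\in\mathbb N^n_{2r}}$, $\ell_y(f)=\sum f_\alpha y_\alpha$, $\mathbf M_t(gy)=(\ell_y(g\,\mathbf x^{\alpha+\beta}))_{\alpha,\beta\in\mathbb N^n_t}$, $\mathbf M_t(y)=\mathbf M_t(1\,y)$. $\mathrm{mlb}(f,\mathcal Q(\mathcal X))_r=\inf\{\ell_y(f):y\in\mathbb R^{s(n,2r)},\ y_0=1,\ \mathbf M_r(y)\succeq0,\ \mathbf M_{r-1}((R^2-\|\mathbf x\|^2)y)=0\}$. $\mathrm{lb}(f,\mathcal Q(\mathcal X))_r=\sup\{a\in\mathbb R:f-a\in\mathcal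 Q(\mathcal X)_{2r}\}$ with $\mathcal Q(\mathcal X)_{2r}=\{\sigma+\tau\,(R^2-\|\mathbf x\|^2):\sigma\in\Sigma[\mathbf x]_{2r},\ \tau\in\mathbb R[\mathbf x],\ \deg\tau\le2r-2\}$. *)

(* Defs.v *)
From HB Require Import structures.
From mathcomp Require Import all_boot all_order all_algebra.
(* mpoly has to be imported before the topological part of MathComp-Analysis:
   in the other order the notations of the two libraries clash. *)
From mathcomp Require Import mpoly.
From mathcomp Require Import all_classical all_reals.
From mathcomp Require Import ereal topology normedtype landau derive realfun.

Set Implicit Arguments.
Unset Strict Implicit.
Unset Printing Implicit Defensive.

Import Order.TTheory GRing.Theory Num.Theory.
Import numFieldNormedType.Exports.

Local Open Scope classical_set_scope.
Local Open Scope ring_scope.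

Definition is_minimum (K : realType) (A : set K) (m : K) : Prop :=
  A m /\ lbound A m.

Section MomentSOS.
Context {K : realType} {n : nat}.
Implicit Types (rho : K) (f g : {mpoly K[n]}).

(* The norm that MathComp-Analysis puts on 'rV[K]_n is the sup norm, hence the
   explicit Euclidean norm. *)
Definition euclidean_norm (x : 'rV[K]_n) : K :=
  Num.sqrt (\sum_(i < n) x 0 i ^+ 2).

Definition sphere rho : set 'rV[K]_n := [set x | euclidean_norm x = rho].

Definition peval f (x : 'rV[K]_n) : K := f.@[x 0].

Definition sphere_poly rho : {mpoly K[n]} :=
  (rho ^+ 2)%:MP - \sum_(i < n) 'X_i ^+ 2.

(* In all degree bounds below, recall that msize p is 1 + deg p, and 0 for
   p = 0. *)
Definition sos (d : nat) : set {mpoly K[n]} :=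
  [set p | (exists s : seq {mpoly K[n]}, p = \sum_(q <- s) q ^+ 2) /\
           (msize p <= d.+1)%N].

(* msize tau <= 2r - 1 says deg tau <= 2r - 2. *)
Definition qmodule rho (r : nat) : set {mpoly K[n]} :=
  [set p | exists sigma tau : {mpoly K[n]},
     [/\ sos (2 * r) sigma, (msize tau <= (2 * r).-1)%N &
         p = sigma + tau * sphere_poly rho]].

(* 'X_{1..n < d.+1} is the finite type of the exponents of degree <= d; it has
   binomial(n + d, n) elements. *)
Definition momseq (d : nat) : Type := {ffun 'X_{1..n < d.+1} -> K}.

(* Meaningful for msize f <= d.+1 only: the terms of f of degree > d are
   dropped. *)
Definition riesz (d : nat) (y : momseq d) f : K :=
  \sum_(a : 'X_{1..n < d.+1}) f@_a * y a.

Definition exponent (t : nat) (i : 'I_#|{: 'X_{1..n < t.+1}}|) :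
    'X_{1..n < t.+1} := enum_val i.

Definition moment_mx (d t : nat) g (y : momseq d) :
    'M[K]_#|{: 'X_{1..n < t.+1}}| :=
  \matrix_(i, j) riesz y (g * 'X_[(exponent i + exponent j)%MM]).

Definition psdmx (m : nat) (A : 'M[K]_m) : Prop :=
  A \is symmetricmx /\ forall v : 'cV[K]_m, 0 <= (v^T *m A *m v) 0 0.

(* r.-1 is r - 1 for r >= 1; the order r = 0 is not meaningful. *)
Definition mlb_feasible rho (r : nat) : set (momseq (2 * r)) :=
  [set y : momseq (2 * r) | [/\ y bm0 = 1, psdmx (moment_mx r 1 y) &
               moment_mx r.-1 (sphere_poly rho) y = 0]].
Arguments mlb_feasible : clear implicits.

Definition mlb rho f (r : nat) : \bar K :=
  ereal_inf [set (riesz y f)%:E | y in mlb_feasible rho r].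

Definition lb rho f (r : nat) : \bar K :=
  ereal_sup [set a%:E | a in [set a : K | qmodule rho r (f - a%:MP)]].

Lemma coordX_continuous (i : 'I_n) (k : nat) :
  continuous (fun x : 'rV[K]_n => x 0 i ^+ k).
Proof.
move=> x; apply: (@continuous_comp _ _ _ (fun y : 'rV[K]_n => y 0 i)
  (fun t : K => t ^+ k)); first exact: coord_continuous.
exact: exprn_continuous.
Qed.

Lemma peval_continuous f : continuous (peval f).
Proof.
rewrite (_ : peval f = fun y : 'rV[K]_n =>
  \sum_(m <- msupp f) f@_m * \prod_(i < n) y 0 i ^+ m i); last first.
  by apply/funext => y; rewrite /peval mevalE.
apply: (@continuous_big K _ _ _ predT); first exact: add_continuous.
move=> m _ x; apply: continuousM; first exact: cst_continuous.
apply: (@continuous_big K _ _ _ predT); first exact: mul_continuous.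
by move=> i _; exact: coordX_continuous.
Qed.

Lemma euclidean_norm_continuous : continuous euclidean_norm.
Proof.
move=> x; apply: (@continuous_comp _ _ _ (fun y : 'rV[K]_n =>
  \sum_(i < n) y 0 i ^+ 2)); last exact: sqrt_continuous.
apply: (@continuous_big K _ _ _ predT); first exact: add_continuous.
by move=> i _; exact: coordX_continuous.
Qed.

Lemma ler_euclidean_norm (x : 'rV[K]_n) i : `|x 0 i| <= euclidean_norm x.
Proof.
rewrite -sqrtr_sqr ler_wsqrtr// (bigD1 i)//= lerDl.
by apply: sumr_ge0 => j _; exact: sqr_ge0.
Qed.

Lemma sphere_nonempty rho : (0 < n)%N -> 0 < rho -> sphere rho !=set0.
Proof.
move=> n0 rho0; exists (\row_j (if j == Ordinal n0 then rho else 0)).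
rewrite /sphere /= /euclidean_norm (bigD1 (Ordinal n0))//= big1.
  by rewrite mxE eqxx addr0 sqrtr_sqr gtr0_norm.
by move=> j /negPf j0; rewrite mxE j0 expr0n.
Qed.

Lemma sphere_compact rho : 0 < rho -> compact (sphere rho).
Proof.
move=> rho0; apply: bounded_closed_compact.
  exists rho; split; first exact: num_real.
  move=> M rhoM x /= xrho; apply/ltW/(le_lt_trans _ rhoM).
  rewrite [`|x|]mx_normrE; apply: bigmax_le => [|[i j] _ /=]; first exact: ltW.
  by rewrite ord1 -xrho; exact: ler_euclidean_norm.
apply: (@preimage_closed _ _ euclidean_norm [set rho]).
  by move=> x _; exact: euclidean_norm_continuous.
exact: closed_eq.
Qed.

Lemma minimum_on_sphere rho f : (0 < n)%N -> 0 < rho ->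
  exists m, is_minimum (peval f @` sphere rho) m.
Proof.
move=> n0 rho0.
have [] := @EVT_min_rV _ _ (peval f) _ (sphere_nonempty n0 rho0)
  (sphere_compact rho0).
  by apply: continuous_subspaceT; exact: peval_continuous.
move=> c; rewrite inE => cS fc; exists (peval f c); split; first by exists c.
by move=> _ [x xS <-]; apply: fc; rewrite inE.
Qed.

End MomentSOS.
Arguments mlb_feasible {K n} rho r _.

(* Main.v *)
(* The lower bounds come from a polynomial kernel.  Let [L] be the average over
   the sphere and let [q] be a univariate polynomial of degree at most [r],
   normalised by [L_y (q(<x, y>)^2) = 1] on the unit sphere.  Then
   [T f (x) = L_y (q(<x, y>)^2 f(y))] is a sum of squares in [x] whenever [f] is
   nonnegative on the sphere, because the associated Gram matrix is positive
   semidefinite.  The average of [f] over the parallel of height [t] around [x]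
   is [sum_l a_l(t) b_l(x)], with finitely many polynomials [a_l], [b_l] that do
   not depend on [q]; hence [T f - f] is a combination of the [b_l] with
   coefficients bounded by a multiple of [L_y (q(<x, y>)^2 (1 - <x, y>))].  A sum
   of Christoffel-Darboux kernels of Gegenbauer polynomials makes this quantity
   [O(1 / r^2)], and [c + e b_l] is a sum of squares on the sphere for [e = 1, -1]
   and a constant [c], so that [f + O(1 / r^2)] is one too.  [L] is given by
   its moments; its positivity is that of Gaussian averages, obtained as limits
   of averages over random walks. *)
Require Import Defs.
From HB Require Import structures.
From mathcomp Require Import all_boot all_order all_algebra.
From mathcomp Require Import ssrcomplements mpoly.
From mathcomp Require Import all_classical all_reals.
From mathcomp Require Import ereal topology normedtype sequences landau realfun.
From mathcomp Require Import ring lra zify.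

Set Implicit Arguments.
Unset Strict Implicit.
Unset Printing Implicit Defensive.

Import Order.TTheory GRing.Theory Num.Theory.
Import numFieldNormedType.Exports.

Local Open Scope classical_set_scope.
Local Open Scope ring_scope.

(** * Polynomials vanishing everywhere *)

Section VanishingPolynomials.
Context {K : realType} {n : nat}.
Implicit Types (p q : {mpoly K[n]}) (v : 'I_n -> K).

(** The operator [T] is neither inverted nor diagonalised. It is applied to [f - fmin] itself, and
    its error is repaired afterwards by a constant: the certificates of [c + e b_l] have a degree
    that does not depend on [r], so they fit once [r] is large. No splitting of [f] into homogeneous
    or harmonic parts enters, which is why an inhomogeneous [f] costs nothing extra. One number
    controls every error term because [a_l(t) - a_l(1)] is divisible by [1 - t], with a quotient
    bounded on [[-1, 1]]. All identities for [L] come from one rule, integration by parts on the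
    sphere, inherited from Stein's identity for Gaussians. Positivity is the only analytic input.
    For [n = 1] there are no parallels to average over, and the factor [n + 2 j - 1] by which the
    recurrences divide vanishes at [j = 0]; the two points of that sphere are treated by hand. *)

Lemma mpoly_ring_ind (P : {mpoly K[n]} -> Prop) :
  (forall c, P c%:MP) -> (forall i, P 'X_i) ->
  (forall p q, P p -> P q -> P (p + q)) ->
  (forall p q, P p -> P q -> P (p * q)) ->
  forall p, P p.
Proof.
move=> PC PX PD PM p; rewrite [p]mpolyE; apply: (big_ind P) => //.
  by rewrite -mpolyC0; exact: PC.
move=> m _; rewrite -mul_mpolyC; apply: (PM); first exact: PC.
rewrite mpolyXE_id; apply: (big_ind P); [|exact: PM|].
  by rewrite -mpolyC1; exact: PC.
move=> i _; suff PXn k : P ('X_i ^+ k) by exact: PXn.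
elim: k => [|k IHk]; first by rewrite expr0 -mpolyC1; exact: PC.
by rewrite exprS; exact: PM.
Qed.

Lemma meval_at0 p : p.@[fun=> 0] = p@_0.
Proof.
elim/mpoly_ring_ind: p => [c|i|p q Hp Hq|p q Hp Hq].
- by rewrite mevalC mcoeffC eqxx mulr1.
- by rewrite mevalXU mcoeffX mnm1_eq0.
- by rewrite mevalD mcoeffD Hp Hq.
- by rewrite mevalM rmorphM /= Hp Hq.
Qed.

(** The restriction of [p] to the line through [v] in direction [i]; it brings in the bound on the
    number of roots of a univariate polynomial. *)
Definition mline i v p : {poly K} :=
  mmap (@polyC K) (fun j => (v j)%:P + (j == i)%:R *: 'X) p.

Lemma horner_mline i v p (t : K) :
  (mline i v p).[t] = p.@[fun j => v j + (j == i)%:R * t].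
Proof.
rewrite /mline; elim/mpoly_ring_ind: p => [c|j|p q Hp Hq|p q Hp Hq].
- by rewrite mmapC mevalC hornerC.
- by rewrite mmapX mmap1U mevalXU !hornerE.
- by rewrite mmapD mevalD hornerD Hp Hq.
- by rewrite rmorphM /= mevalM hornerM Hp Hq.
Qed.

Lemma deriv_mline i v p : (mline i v p)^`() = mline i v p^`M(i).
Proof.
rewrite /mline; elim/mpoly_ring_ind: p => [c|j|p q Hp Hq|p q Hp Hq].
- by rewrite mmapC mderivC mmap0 derivC.
- rewrite mmapX mmap1U derivD derivC add0r derivZ derivX mderivX mnm1E.
  case: (eqVneq j i) => [->|_]; last by rewrite !scale0r mmap0.
  have -> : (U_(i) - U_(i) = 0 :> 'X_{1..n})%MM.
    by apply/mnmP => k; rewrite mnmBE subnn mnm0E.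
  by rewrite !scale1r mpolyX0 -mpolyC1 mmapC.
- by rewrite mderivD !mmapD derivD Hp Hq.
- by rewrite mderivM rmorphM /= derivM Hp Hq mmapD !rmorphM.
Qed.

Lemma mderiv_eq0_meval i p :
  (forall v, p.@[v] = 0) -> forall v, p^`M(i).@[v] = 0.
Proof.
move=> p0 v; suff mline0: mline i v p = 0.
  rewrite (_ : p^`M(i).@[v] = (mline i v p^`M(i)).[0]).
    by rewrite -deriv_mline mline0 derivC horner0.
  by rewrite horner_mline; apply: meval_eq => j; rewrite mulr0 addr0.
apply/eqP/negPn/negP => nz.
have := max_poly_roots nz (rs := [seq k%:R | k <- iota 0 (size (mline i v p))]).
rewrite size_map size_iota ltnn map_inj_uniq ?iota_uniq; last first.
  by move=> a b /eqP; rewrite eqr_nat => /eqP.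
move=> /(_ _ isT) H; suff: false by []; apply: H.
by apply/allP => _ /mapP[k _ ->]; rewrite /root horner_mline p0.
Qed.

Lemma mpoly_eq0_meval p : (forall v, p.@[v] = 0) -> p = 0.
Proof.
move=> p0; apply/mpolyP => m; rewrite mcoeff0.
have : (p^`M[m]).@[fun=> 0] = 0.
  rewrite /mderivm; elim: (enum _) (fun=> 0) => [|i s IHs] v /=; first exact: p0.
  elim: (m i) v => [|k IHk] v //=; exact: mderiv_eq0_meval.
rewrite meval_at0 mcoeff_mderivm addm0 => /eqP; rewrite mulrn_eq0.
case/orP => [|/eqP//]; rewrite -leqn0 leqNgt prodn_gt0// => i.
by rewrite ffact_gt0.
Qed.
End VanishingPolynomials.

(** * Reduction modulo the equation of the sphere *)

Section SphereIdeal.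
Context {K : realType} {n : nat}.
Implicit Types (p q : {mpoly K[n]}) (v : 'I_n -> K).

Definition on_sphere (rho : K) v : Prop := \sum_(i < n) v i ^+ 2 = rho ^+ 2.

Lemma meval_dhomogZ d p (c : K) v :
  p \is d.-homog -> p.@[fun i => c * v i] = c ^+ d * p.@[v].
Proof.
move=> /dhomogP ph; rewrite !mevalE big_distrr /= !big_seq.
apply: eq_bigr => m /ph /= md; rewrite mulrCA; congr (_ * _).
by rewrite -md mdegE -prodrXr -big_split /=; under eq_bigr do rewrite exprMn.
Qed.

Lemma msizeD_leq k p q :
  (msize p <= k -> msize q <= k -> msize (p + q) <= k)%N.
Proof. by move=> pk qk; rewrite (leq_trans (msizeD_le _ _))// geq_max pk. Qed.

Lemma msizeM_leq a b p q : (msize p <= a.+1 -> msize q <= b.+1 ->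
  msize (p * q) <= (a + b).+1)%N.
Proof.
have [->|p0] := eqVneq p 0; first by rewrite mul0r msize0.
have [->|q0] := eqVneq q 0; first by rewrite mulr0 msize0.
by rewrite msizeM//; move: (mmeasure _ p) (mmeasure _ q) => a' b' *; lia.
Qed.

Lemma dhomog_msize_le d q : q \is d.-homog -> (msize q <= d.+1)%N.
Proof.
move=> /dhomogP qh; rewrite msizeE big_seq; apply/bigmax_leqP_seq => m _ mq.
by rewrite ltnS; have /= -> := qh m mq.
Qed.

Variable rho : K.
Hypothesis rho_gt0 : 0 < rho.
Let rho_neq0 : rho != 0 := lt0r_neq0 rho_gt0.

Local Notation g := (@sphere_poly K n rho).

Lemma meval_sphere_poly v : g.@[v] = rho ^+ 2 - \sum_(i < n) v i ^+ 2.
Proof.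
rewrite /sphere_poly mevalB mevalC (raddf_sum (meval v)) /=; congr (_ - _).
by apply: eq_bigr => i _; rewrite rmorphXn /= mevalXU.
Qed.

Lemma sphere_poly_eq0 v : on_sphere rho v -> g.@[v] = 0.
Proof. by move=> vS; rewrite meval_sphere_poly vS subrr. Qed.

Lemma on_sphereN v : on_sphere rho v -> on_sphere rho (fun i => -1 * v i).
Proof.
by rewrite /on_sphere; under [X in _ -> X = _]eq_bigr do
  rewrite exprMn sqrrN expr1n mul1r.
Qed.

Let sqnorm_homog : \sum_(i < n) 'X_i ^+ 2 \is [in K[n], 2.-homog].
Proof.
by apply: rpred_sum => i _; rewrite mpolyXn dhomogX /= mdegMn mdeg1.
Qed.

(** On the sphere [|x|^2 / rho^2] is 1, so multiplying by it raises the degree by two and changes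
    [q] only by a multiple of the equation. *)
Lemma dhomog_raise k d q : q \is d.-homog ->
  exists E t : {mpoly K[n]}, [/\ E \is (d + k.*2).-homog,
    (msize t <= (d + k.*2).-1)%N & q = E + t * g].
Proof.
elim: k d q => [|k IHk] d q qh.
  by exists q, 0; rewrite addn0 msize0 mul0r addr0.
have [|E [t [Eh tm Et]]] := IHk d.+2 (rho ^- 2 *: (q * \sum_(i < n) 'X_i ^+ 2)).
  apply: dhomogZ; rewrite (_ : d.+2 = (d + 2)%N); last by rewrite addn2.
  exact: dhomogM qh sqnorm_homog.
exists E, (t + rho ^- 2 *: q); rewrite doubleS !addnS -!addSn; split => //.
  apply: msizeD_leq => //; apply: leq_trans (msizeZ_le _ _) _.
  by apply: leq_trans (dhomog_msize_le qh) _; lia.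
rewrite mulrDl addrA -Et -scalerAl -scalerDr -mulrDr addrC subrK.
by rewrite mulrC mul_mpolyC scalerA mulVf ?scale1r// sqrf_eq0.
Qed.

(** Degrees can only be raised by two, hence one form for each parity. Having opposite parity, [E]
    and [F] are separated by their values at [v] and [-v]. *)
Lemma sphere_homogenize D p : (msize p <= D.+2)%N ->
  exists E F t : {mpoly K[n]}, [/\ E \is D.-homog, F \is D.+1.-homog,
    (msize t <= D)%N & p = E + F + t * g].
Proof.
move=> pD; rewrite [p]mpolyE big_seq.
apply: (big_ind (fun p => exists E F t : {mpoly K[n]}, [/\ E \is D.-homog,
  F \is D.+1.-homog, (msize t <= D)%N & p = E + F + t * g])).
- by exists 0, 0, 0; rewrite !rpred0 msize0 mul0r !addr0.
- move=> _ _ [E [F [t [Eh Fh tD ->]]]] [E' [F' [t' [Eh' Fh' tD' ->]]]].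
  exists (E + E'), (F + F'), (t + t'); split; [exact: rpredD|exact: rpredD| |].
    exact: msizeD_leq.
  by ring.
move=> m /msize_mdeg_lt /(leq_trans)/(_ pD); rewrite ltnS => mD.
have ch : p@_m *: 'X_[m] \is (mdeg m).-homog by rewrite dhomogZ// dhomogX.
have [oe|oe] := boolP (odd (D.+1 - mdeg m)).
  have mD' : (mdeg m <= D)%N.
    by rewrite -ltnS ltn_neqAle mD andbT; apply: contraTN oe => /eqP->; rewrite subnn.
  have [E [t []]] := dhomog_raise (D - mdeg m)./2 ch.
  rewrite (_ : mdeg m + _ = D)%N; last first.
    by rewrite even_halfK ?subnKC//; move: oe; rewrite subSn.
  move=> Eh tm ->; exists E, 0, t; rewrite rpred0 addr0; split => //.
  by apply: leq_trans tm _; exact: leq_pred.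
have [F [t []]] := dhomog_raise (D.+1 - mdeg m)./2 ch.
rewrite (_ : mdeg m + _ = D.+1)%N; last first.
  by rewrite even_halfK// subnKC.
by move=> Fh tm ->; exists 0, F, t; rewrite rpred0 add0r.
Qed.

Lemma dhomog_ge0 D p : (0 < D)%N -> p \is D.-homog ->
  (forall v, on_sphere rho v -> 0 <= p.@[v]) -> forall v, 0 <= p.@[v].
Proof.
move=> D0 ph p0 v; pose s := Num.sqrt (\sum_(i < n) v i ^+ 2).
have sumv0 : 0 <= \sum_(i < n) v i ^+ 2 by apply: sumr_ge0 => i _; exact: sqr_ge0.
have s0 : 0 <= s := sqrtr_ge0 _.
have [sv|sN0] := eqVneq s 0.
  have v0 i : v i = 0.
    move: sv => /eqP; rewrite sqrtr_eq0 => sv.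
    have /eqP : \sum_(i < n) v i ^+ 2 = 0 by apply/eqP; rewrite eq_le sv.
    rewrite psumr_eq0; last by move=> j _; exact: sqr_ge0.
    by move=> /allP /(_ i (mem_index_enum _)) /=; rewrite sqrf_eq0 => /eqP.
  rewrite (meval_eq _ (_ : _ =1 fun i => 0 * v i)); last by move=> i; rewrite v0 mulr0.
  by rewrite (meval_dhomogZ _ _ ph) expr0n -[D]prednK//= mul0r.
rewrite (meval_eq _ (_ : _ =1 fun i => s / rho * (rho / s * v i))); last first.
  by move=> i; field; rewrite rho_neq0 sN0.
rewrite (meval_dhomogZ _ _ ph) mulr_ge0// ?exprn_ge0 ?divr_ge0 ?(ltW rho_gt0)//.
apply: p0; rewrite /on_sphere; under eq_bigr do rewrite exprMn.
rewrite -mulr_sumr -[X in _ * X](sqr_sqrtr sumv0) -/s; field.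
exact: sN0.
Qed.

Lemma dhomog_eq0 D p : (0 < D)%N -> p \is D.-homog ->
  (forall v, on_sphere rho v -> p.@[v] = 0) -> p = 0.
Proof.
move=> D0 ph p0; apply: mpoly_eq0_meval => v; apply/eqP; rewrite eq_le.
rewrite -oppr_ge0 -mevalN; apply/andP; split.
  by apply: (dhomog_ge0 D0); rewrite ?rpredN// => u uS; rewrite mevalN p0 ?oppr0.
by apply: (dhomog_ge0 D0) => // u uS; rewrite p0.
Qed.

(** A Nullstellensatz for the sphere with the sharp degree of the cofactor: antipodal points show
    that both forms vanish on the sphere, and by scaling a form of positive degree that does so is
    zero. *)
Lemma sphere_vanishing D p : (0 < D)%N -> (msize p <= D.+2)%N ->
  (forall v, on_sphere rho v -> p.@[v] = 0) ->
  exists2 t : {mpoly K[n]}, (msize t <= D)%N & p = t * g.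
Proof.
move=> D0 pD p0; have [E [F [t [Eh Fh tD pE]]]] := sphere_homogenize pD.
have EO v : on_sphere rho v -> E.@[v] + F.@[v] = 0.
  by move=> vS; move: (p0 v vS); rewrite pE !mevalD mevalM sphere_poly_eq0// mulr0 addr0.
have EO0 v : on_sphere rho v -> E.@[v] = 0 /\ F.@[v] = 0.
  move=> vS; have := EO _ (on_sphereN vS); have := EO v vS.
  rewrite !(meval_dhomogZ _ _ Eh, meval_dhomogZ _ _ Fh) exprS.
  by rewrite -signr_odd; case: (odd D) => /=; rewrite ?expr0 ?expr1; lra.
have E0 : E = 0 by apply: (dhomog_eq0 D0 Eh) => v /EO0[].
have F0 : F = 0 by apply: (dhomog_eq0 (ltn0Sn _) Fh) => v /EO0[].
by exists t; rewrite // pE E0 F0 !add0r.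
Qed.

End SphereIdeal.

(** * Gaussian averages *)

Section GaussianMoments.
Context {K : realType}.
Implicit Types (h : K -> K) (N k : nat).

Fixpoint gauss_moment k : K :=
  match k with
  | 0 => 1
  | 1 => 0
  | k'.+2 => k'.+1%:R * gauss_moment k'
  end.

(** The end points of all [2 ^ N] walks with steps 1 and -1, listed with multiplicity. *)
Fixpoint walk N : seq K :=
  if N is N'.+1 then [seq x + 1 | x <- walk N'] ++ [seq x - 1 | x <- walk N']
  else [:: 0].

Definition walk_mean N h : K := 2 ^- N * \sum_(x <- walk N) h x.

Lemma walk_mean0 h : walk_mean 0 h = h 0.
Proof. by rewrite /walk_mean big_seq1 invr1 mul1r. Qed.

Lemma walk_meanS N h :
  walk_mean N.+1 h = walk_mean N (fun x => (h (x + 1) + h (x - 1)) / 2).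
Proof.
rewrite /walk_mean /= big_cat /= !big_map -big_split /= -mulr_suml.
by rewrite exprSr invfM mulrAC mulrA.
Qed.

Lemma eq_walk_mean N h1 h2 : h1 =1 h2 -> walk_mean N h1 = walk_mean N h2.
Proof. by move=> h12; rewrite /walk_mean; under eq_bigr do rewrite h12. Qed.

Lemma walk_meanD N h1 h2 :
  walk_mean N (fun x => h1 x + h2 x) = walk_mean N h1 + walk_mean N h2.
Proof. by rewrite /walk_mean big_split mulrDr. Qed.

Lemma walk_meanZ N (c : K) h : walk_mean N (fun x => c * h x) = c * walk_mean N h.
Proof. by rewrite /walk_mean -mulr_sumr mulrCA. Qed.

Lemma walk_mean_sum N (I : Type) (r : seq I) (F : I -> K -> K) :
  walk_mean N (fun x => \sum_(i <- r) F i x) = \sum_(i <- r) walk_mean N (F i).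
Proof. by rewrite /walk_mean exchange_big /= mulr_sumr. Qed.

(** Discrete Stein identity: the end point is a sum of [N + 1] exchangeable signs, each contributing
    the same half difference of [h]. *)
Lemma walk_mean_stein N h : walk_mean N.+1 (fun x => x * h x) =
  N.+1%:R * walk_mean N (fun x => (h (x + 1) - h (x - 1)) / 2).
Proof.
elim: N h => [|N IHN] h; first by rewrite walk_meanS !walk_mean0; field.
rewrite walk_meanS.
rewrite (@eq_walk_mean _ _ (fun x => x * ((h (x + 1) + h (x - 1)) / 2) +
  (h (x + 1) - h (x - 1)) / 2)); last by move=> x; field.
rewrite walk_meanD IHN -[N.+2%:R]natr1 [RHS]mulrDl mul1r; congr (N.+1%:R * _ + _).
by rewrite [RHS]walk_meanS; apply: eq_walk_mean => x; rewrite !subrK !addrK; field.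
Qed.

(** The walk has [N + 1] steps so that the scaling factor is never zero. *)
Definition scaled_moment N k : K :=
  walk_mean N.+1 (fun x => x ^+ k) / Num.sqrt N.+1%:R ^+ k.

Let s N : K := Num.sqrt N.+2%:R.

Lemma scaled_momentS N k : scaled_moment N.+1 k.+1 =
  \sum_(j < k.+1) (odd j)%:R * ('C(k, j)%:R * (scaled_moment N (k - j) *
    ((Num.sqrt N.+1%:R / s N) ^+ (k - j) * (s N)^-1 ^+ j.-1))).
Proof.
rewrite /scaled_moment (@eq_walk_mean N.+2 _ (fun x => x * x ^+ k)); last first.
  by move=> x; rewrite exprS.
rewrite (walk_mean_stein N.+1 (fun x => x ^+ k)).
rewrite (@eq_walk_mean _ _ (fun x => \sum_(j < k.+1)
  (odd j)%:R * 'C(k, j)%:R * x ^+ (k - j))); last first.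
  move=> x; rewrite !exprDn -sumrB mulr_suml; apply: eq_bigr => j _.
  rewrite expr1n mulr1 -[(-1) ^+ j]signr_odd -mulrnBl -[(_ - _) *+ _]mulr_natl.
  move: ('C(k, j)%:R) (x ^+ (k - j)) => c y.
  by case: (odd j); rewrite ?expr1 ?expr0 ?mulr1n ?mulr0n; field.
rewrite walk_mean_sum mulr_sumr mulr_suml; apply: eq_bigr => -[j /= jk] _.
rewrite walk_meanZ; have [oj|] := boolP (odd j); last by rewrite !mul0r mulr0 mul0r.
have sN0 : s N != 0 by rewrite sqrtr_eq0 -ltNge ltr0n.
have s'N0 : Num.sqrt N.+1%:R != 0 :> K by rewrite sqrtr_eq0 -ltNge ltr0n.
rewrite -/(s N).
have -> : N.+2%:R = s N ^+ 2 by rewrite sqr_sqrtr ?ler0n.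
rewrite !mul1r exprMn !exprVn.
have -> : k.+1 = ((k - j) + j.-1 + 2)%N by case: j jk oj => // j; lia.
rewrite !exprD; field.
by rewrite !expf_neq0 ?sN0.
Qed.

Lemma cvg_exprn (u : K^nat) (a : K) k :
  u @ \oo --> a -> (fun N => u N ^+ k) @ \oo --> a ^+ k.
Proof. by move=> ua; apply: (@cvg_comp _ _ _ u (fun t => t ^+ k)) ua _; exact: exprn_continuous. Qed.

Lemma cvg_scaled_moment k : (fun N => scaled_moment N k) @ \oo --> gauss_moment k.
Proof.
have inv0 : (fun N => (s N)^-1) @ \oo --> (0 : K).
  rewrite -[X in _ --> X]sqrtr0.
  rewrite (_ : (fun N => _) = (fun N => Num.sqrt (@harmonic K N.+1))); last first.
    by apply/funext => N; rewrite /harmonic /= sqrtrV// ler0n.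
  apply: (@cvg_comp _ _ _ (fun N => @harmonic K N.+1) Num.sqrt); last exact: sqrt_continuous.
  by rewrite cvg_shiftS; exact: cvg_harmonic.
have ratio1 : (fun N => Num.sqrt N.+1%:R / s N) @ \oo --> (1 : K).
  rewrite -[X in _ --> X]sqrtr1.
  rewrite (_ : (fun N => _) = (fun N => Num.sqrt (1 - @harmonic K N.+1))); last first.
    apply/funext => N; rewrite /harmonic /= -sqrtrV ?ler0n// -sqrtrM ?ler0n//.
    have -> : N.+1%:R = N.+2%:R - 1 :> K by rewrite -[N.+2]addn1 natrD addrK.
    by rewrite mulrBl mul1r divff// pnatr_eq0.
  have ratio_sqr : (fun N => 1 - @harmonic K N.+1) @ \oo --> (1 - 0 : K).
    by apply: cvgB; [exact: cvg_cst|rewrite cvg_shiftS; exact: cvg_harmonic].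
  rewrite subr0 in ratio_sqr.
  exact: (@cvg_comp _ _ _ _ Num.sqrt _ _ _ ratio_sqr (@sqrt_continuous _ _)).
elim/ltn_ind: k => -[|k] IHk.
  rewrite /scaled_moment (_ : (fun N => _) = fun=> 1); first exact: cvg_cst.
  apply/funext => N; rewrite expr0 divr1; elim: N.+1 => [|M IHM].
    by rewrite walk_mean0.
  by rewrite walk_meanS -[RHS]IHM; apply: eq_walk_mean => x; rewrite !expr0; field.
rewrite -cvg_shiftS.
under eq_fun do rewrite scaled_momentS.
(* In the limit only [j = 1] survives: even [j] carry the factor 0, and odd [j > 1] carry a positive
   power of 0. *)
have -> : gauss_moment k.+1 = \sum_(j < k.+1) (odd j)%:R * ('C(k, j)%:R *
    (gauss_moment (k - j) * (1 ^+ (k - j) * 0 ^+ j.-1))).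
  case: k {IHk} => [|k] /=; first by rewrite big_ord1 mul0r.
  rewrite big_ord_recl big_ord_recl big1 => [|i _] /=.
    by rewrite (_ : bump 0 0 = 1%N)// bin1 subn1 !expr1n; ring.
  by rewrite expr0n !mulr0.
apply: cvg_big => [|j _]; first exact: add_continuous.
apply: cvgM; first exact: cvg_cst.
apply: cvgM; first exact: cvg_cst.
apply: cvgM; first by apply: IHk; rewrite ltnS leq_subr.
by apply: cvgM; exact: cvg_exprn.
Qed.

Context {n : nat}.
Implicit Types (p : {mpoly K[n]}).

Definition gauss_mean p : K :=
  \sum_(m <- msupp p) p@_m * \prod_(i < n) gauss_moment (m i).

Lemma gauss_mean_ge0 p : (forall v, 0 <= p.@[v]) -> 0 <= gauss_mean p.
Proof.
move=> p0; have cv : (fun N => \sum_(m <- msupp p)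
    p@_m * \prod_(i < n) scaled_moment N (m i)) @ \oo --> gauss_mean p.
  apply: cvg_big => [|m _]; first exact: add_continuous.
  apply: cvgM; first exact: cvg_cst.
  apply: cvg_big => [|i _]; first exact: mul_continuous.
  exact: cvg_scaled_moment.
apply: (cvgr_to_ge cv); apply: nearW => N; pose M := size (walk N.+1).
pose c := 2 ^- N.+1 : K; pose x (j : 'I_M) : K := (walk N.+1)`_j / Num.sqrt N.+1%:R.
(* The coordinates are independent walks: [F] selects one end point per coordinate, and the sum is
   an average of values of [p]. *)
rewrite (_ : \sum_(m <- _) _ =
  \sum_(F : {ffun 'I_n -> 'I_M}) c ^+ n * p.@[fun i => x (F i)]).
  by apply: sumr_ge0 => F _; rewrite mulr_ge0// exprn_ge0// invr_ge0 exprn_ge0.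
under [RHS]eq_bigr do rewrite mevalE mulr_sumr.
rewrite exchange_big /=; apply: eq_bigr => m _.
under [RHS]eq_bigr do rewrite mulrCA.
rewrite -mulr_sumr; congr (_ * _).
have sE k : scaled_moment N k = \sum_(j < M) c * x j ^+ k.
  rewrite /scaled_moment /walk_mean (big_nth 0) big_mkord mulr_sumr mulr_suml.
  by apply: eq_bigr => j _; rewrite exprMn exprVn mulrA.
under eq_bigr do rewrite sE.
rewrite bigA_distr_bigA /=; apply: eq_bigr => F _.
by rewrite big_split /= prodr_const card_ord.
Qed.

End GaussianMoments.

(** * The average over the sphere *)

Section SphereMean.
Context {K : realType} {n : nat}.
Implicit Types (p q : {mpoly K[n]}) (m : 'X_{1..n}) (lam : 'X_{1..n} -> K).

Fact mlin_key : unit. Proof. exact: tt. Qed.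

Definition mlin lam : {mpoly K[n]} -> K :=
  locked_with mlin_key (fun p => \sum_(m <- msupp p) p@_m * lam m).

Lemma mlinE lam p : mlin lam p = \sum_(m <- msupp p) p@_m * lam m.
Proof. by rewrite /mlin unlock. Qed.

Lemma mlinwE lam k p : (msize p <= k)%N ->
  mlin lam p = \sum_(m : 'X_{1..n < k}) p@_m * lam m.
Proof.
move=> pk; rewrite mlinE (big_mksub 'X_{1..n < k}) //=; first last.
  by move=> x /msize_mdeg_lt /leq_trans; apply.
  by rewrite msupp_uniq.
rewrite big_rmcond //= => m /memN_msupp_eq0 ->.
by rewrite mul0r.
Qed.

Lemma mlin_is_linear lam : linear_for *%R (mlin lam).
Proof.
move=> c p q; pose k := maxn (msize p) (msize q).
have pk : (msize p <= k)%N by rewrite leq_maxl.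
have qk : (msize q <= k)%N by rewrite leq_maxr.
have pqk : (msize (c *: p + q) <= k)%N.
  by apply: msizeD_leq => //; exact: leq_trans (msizeZ_le _ _) pk.
rewrite !(mlinwE _ pk, mlinwE _ qk, mlinwE _ pqk) mulr_sumr -big_split /=.
by apply: eq_bigr => m _; rewrite mcoeffD mcoeffZ mulrDl mulrA.
Qed.

HB.instance Definition _ lam :=
  GRing.isLinear.Build K {mpoly K[n]} K *%R (mlin lam) (mlin_is_linear lam).

Lemma mlinX lam m : mlin lam 'X_[m] = lam m.
Proof. by rewrite mlinE msuppX big_seq1 mcoeffX eqxx mul1r. Qed.

Lemma mlinZ lam c p : mlin lam (c *: p) = c * mlin lam p.
Proof. exact: linearZ. Qed.

(* For even [s] this is the mean of [|x| ^ s] under the standard Gaussian; the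
   values at odd [s] only ever multiply a vanishing Gaussian moment. *)
Fixpoint radial_moment (s : nat) : K :=
  match s with
  | 0 | 1 => 1
  | s'.+2 => (n + s')%:R * radial_moment s'
  end.

Hypothesis n_gt0 : (0 < n)%N.

Lemma radial_moment_gt0 s : 0 < radial_moment s.
Proof.
elim/ltn_ind: s => -[|[|s]] IHs //=.
by rewrite mulr_gt0 ?IHs// ltr0n addn_gt0 n_gt0.
Qed.

Lemma gauss_moment_odd k : odd k -> gauss_moment k = 0 :> K.
Proof.
elim/ltn_ind: k => -[|[|k]] IHk //=; rewrite negbK => ok.
by rewrite IHk// mulr0.
Qed.

Variable rho : K.
Hypothesis rho_gt0 : 0 < rho.

(** A standard Gaussian vector is a radius times an independent uniform direction, so its moments
    factor. Dividing by the radial factor leaves the moment of the direction, which [rho]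
    rescales. *)
Definition sphere_moment m : K :=
  rho ^+ mdeg m * \prod_(i < n) gauss_moment (m i) / radial_moment (mdeg m).

Definition sphere_mean := mlin sphere_moment.
HB.instance Definition _ := GRing.Linear.on sphere_mean.

Local Notation L := sphere_mean.

(** Integration by parts on the sphere: the Gaussian rule equates the means of [x_i p] and of the
    derivative of [p], and [n + mdeg m - 1] is the quotient of the two radial factors. *)
Lemma sphere_meanX_deriv i m :
  ((n + mdeg m)%:R - 1) * L ('X_i * 'X_[m]) = rho ^+ 2 * L 'X_[m]^`M(i).
Proof.
rewrite mderivX -mpolyXD /sphere_mean mlinZ !mlinX /sphere_moment mdegD mdeg1.
rewrite (bigD1 i)//= mnmDE mnm1E eqxx.
case mi: (m i) => [|k] /=; first by rewrite mul0r mulr0 !mul0r !mulr0.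
have mU : (U_(i) + (m - U_(i)) = m)%MM.
  by rewrite addmC submK// lep1mP mi.
rewrite [X in _ = _ * (_ * (_ * X / _))](bigD1 i)//= mnmBE mnm1E eqxx mi subn1 /=.
have degm : mdeg m = (mdeg (m - U_(i))%MM).+1 by rewrite -[in LHS]mU mdegD mdeg1.
rewrite degm; move: (mdeg _) => d /=.
under eq_bigr => j /negPf ji do rewrite mnmDE mnm1E eq_sym ji add0n.
under [in RHS]eq_bigr => j /negPf ji do rewrite mnmBE mnm1E eq_sym ji subn0.
have := radial_moment_gt0 d; move: (radial_moment d) => z z0.
have nd0 : n%:R + d%:R != 0 :> K by rewrite -natrD pnatr_eq0 addn_eq0 -leqn0 leqNgt n_gt0.
rewrite -natr1 !natrD -[d.+1%:R]natr1 add1n !exprS expr0; field.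
by rewrite nd0 lt0r_neq0.
Qed.

Lemma sphere_mean_deriv d i p : p \is d.-homog ->
  ((n + d)%:R - 1) * L ('X_i * p) = rho ^+ 2 * L p^`M(i).
Proof.
move=> /dhomogP ph; rewrite [p]mpolyE mulr_sumr (linear_sum (mderiv i)) !(linear_sum L) /= !mulr_sumr.
rewrite !big_seq; apply: eq_bigr => m /ph /= <-.
rewrite -scalerAr mderivZ !linearZ /= mulrCA sphere_meanX_deriv.
by rewrite mulrCA.
Qed.

(** Integration by parts applied to [x_i] times a monomial, summed over [i]: the factors [m i + 1]
    add up to [n + mdeg m]. *)
Lemma sphere_mean_ideal p : L (p * sphere_poly rho) = 0.
Proof.
rewrite [p]mpolyE mulr_suml (linear_sum L) big1_seq//= => m _.
rewrite -scalerAl linearZ /=; apply/eqP; rewrite mulf_eq0; apply/orP; right.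
rewrite mulrBr [_ * _%:MP]mulrC mul_mpolyC linearB linearZ /= subr_eq0.
rewrite mulr_sumr (linear_sum L) /=.
have nm0 : (n + mdeg m)%:R != 0 :> K by rewrite pnatr_eq0 addn_eq0 -leqn0 leqNgt n_gt0.
apply/eqP/(mulfI nm0); rewrite mulr_sumr.
have key i : (n + mdeg m)%:R * L ('X_[m] * 'X_i ^+ 2) = rho ^+ 2 * ((m i).+1%:R * L 'X_[m]).
  have := sphere_meanX_deriv i (U_(i) + m); rewrite mdegD mdeg1 addnA addn1 addSn.
  rewrite -natr1 addrK mpolyXD mulrA -expr2 [_ * 'X_[m]]mulrC => ->.
  rewrite -mpolyXD mderivX mnmDE mnm1E eqxx add1n linearZ /=.
  by rewrite addmC addmK.
under eq_bigr do rewrite key.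
rewrite -mulr_sumr -mulr_suml mulrCA; congr (_ * (_ * _)).
rewrite natrD mdegE natr_sum; under [RHS]eq_bigr do rewrite -natr1.
by rewrite big_split /= sumr_const card_ord addrC.
Qed.

Lemma sphere_mean_dhomog d p : p \is d.-homog ->
  L p = rho ^+ d / radial_moment d * gauss_mean p.
Proof.
move=> /dhomogP ph; rewrite /L /sphere_mean mlinE /gauss_mean mulr_sumr !big_seq.
by apply: eq_bigr => m /ph /= md; rewrite /sphere_moment md; ring.
Qed.

Lemma sphere_mean_odd d p : odd d -> p \is d.-homog -> L p = 0.
Proof.
move=> od ph; rewrite (sphere_mean_dhomog ph) /gauss_mean big1_seq ?mulr0//=.
move=> m mp; have /dhomogP/(_ m mp) /= md := ph.
have [i oi] : exists i, odd (m i).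
  apply/existsP; apply: contraLR od; rewrite -md negb_exists => /forallP em.
  rewrite mdegE; apply: (big_ind (fun k => ~~ odd k)) => // a b.
  by rewrite oddD => /negPf-> /negPf->.
by rewrite (bigD1 i)//= gauss_moment_odd// mul0r mulr0.
Qed.

Lemma sphere_mean_ge0 p :
  (forall v, on_sphere rho v -> 0 <= p.@[v]) -> 0 <= L p.
Proof.
(* [D] is even, so [F] is odd and has mean 0, while [E] takes at [v] the average of [p] at [v] and
   [-v]. Being nonnegative on the sphere, the form [E] is so everywhere and Gaussian positivity
   applies. *)
move=> p0; pose D := (msize p).*2.+2.
have pD : (msize p <= D.+2)%N by rewrite /D; lia.
have D0 : (0 < D)%N by [].
have eD : ~~ odd D by rewrite /D /= odd_double.
have [E [F [t [Eh Fh tD pE]]]] := sphere_homogenize rho_gt0 pD.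
have -> : L p = L E.
  rewrite pE !linearD /= sphere_mean_ideal addr0.
  by rewrite (@sphere_mean_odd D.+1 F) ?addr0.
rewrite (sphere_mean_dhomog Eh) mulr_ge0 ?divr_ge0 ?exprn_ge0 ?(ltW rho_gt0)//.
  exact/ltW/radial_moment_gt0.
apply: gauss_mean_ge0; apply: (dhomog_ge0 rho_gt0 D0 Eh) => v vS.
have := p0 v vS; have := p0 _ (on_sphereN vS).
rewrite pE !mevalD !mevalM !sphere_poly_eq0//; last exact: on_sphereN.
rewrite !(meval_dhomogZ _ _ Eh, meval_dhomogZ _ _ Fh) exprS -signr_odd.
by rewrite (negPf eD); lra.
Qed.

End SphereMean.

(** * Sums of squares on the sphere *)

Section SphereSOS.
Context {K : realType} {n : nat}.
Variable rho : K.
Implicit Types (p q : {mpoly K[n]}) (v : 'I_n -> K).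

(** Only values on the sphere are compared, so no cofactor of the equation has to be tracked;
    [sphere_vanishing] recovers it at the end. The bound [d] is on the polynomials before
    squaring. *)
Definition sphere_sos d p : Prop := exists2 s : seq {mpoly K[n]},
  all (fun q => msize q <= d.+1)%N s &
  forall v, on_sphere rho v -> p.@[v] = \sum_(q <- s) q.@[v] ^+ 2.

Lemma sphere_sosW d e p : (d <= e)%N -> sphere_sos d p -> sphere_sos e p.
Proof.
move=> de [s sd ps]; exists s => //; apply: sub_all sd => q /leq_trans; apply.
by rewrite ltnS.
Qed.

Lemma sphere_sosD d p q : sphere_sos d p -> sphere_sos d q -> sphere_sos d (p + q).
Proof.
move=> [s sd ps] [t td qt]; exists (s ++ t); first by rewrite all_cat sd.
by move=> v vS; rewrite mevalD ps// qt// big_cat.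
Qed.

Lemma sphere_sos_sqr d p : (msize p <= d.+1)%N -> sphere_sos d (p ^+ 2).
Proof.
move=> pd; exists [:: p]; first by rewrite /= pd.
by move=> v vS; rewrite big_seq1 rmorphXn.
Qed.

Lemma sphere_sosZ d (c : K) p : 0 <= c -> sphere_sos d p -> sphere_sos d (c *: p).
Proof.
move=> c0 [s sd ps]; exists [seq Num.sqrt c *: q | q <- s].
  by rewrite all_map; apply: sub_all sd => q /=; apply: leq_trans; exact: msizeZ_le.
move=> v vS; rewrite mevalZ ps// big_map mulr_sumr; apply: eq_bigr => q _.
by rewrite mevalZ exprMn sqr_sqrtr.
Qed.

Lemma sphere_sosC d (c : K) : 0 <= c -> sphere_sos d c%:MP.
Proof.
move=> c0; rewrite -[c%:MP]mulr1 mul_mpolyC -(expr1n _ 2).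
by apply: sphere_sosZ => //; apply: sphere_sos_sqr; rewrite msize1.
Qed.

Lemma sphere_sos_eq d p q : (forall v, on_sphere rho v -> p.@[v] = q.@[v]) ->
  sphere_sos d p -> sphere_sos d q.
Proof. by move=> pq [s sd ps]; exists s => // v vS; rewrite -pq// ps. Qed.

Lemma sphere_sos_sum d (I : Type) (r : seq I) (F : I -> {mpoly K[n]}) :
  (forall i, sphere_sos d (F i)) -> sphere_sos d (\sum_(i <- r) F i).
Proof.
move=> Fs; apply: (big_ind (sphere_sos d)) => //; last exact: sphere_sosD.
by rewrite -mpolyC0; exact: sphere_sosC.
Qed.

Lemma sphere_sosM_sqr d e p q :
  sphere_sos d p -> (msize q <= e.+1)%N -> sphere_sos (d + e) (p * q ^+ 2).
Proof.
move=> [s sd ps] qe; exists [seq t * q | t <- s].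
  by rewrite all_map; apply: sub_all sd => t td /=; exact: msizeM_leq.
move=> v vS; rewrite mevalM rmorphXn /= ps// big_map mulr_suml.
by apply: eq_bigr => t _; rewrite mevalM exprMn.
Qed.

(** The bounded elements of an ordered ring form a subring. Here it contains the constants and, by
    the equation of the sphere, the coordinates, hence everything. *)
Definition sphere_bounded p : Prop :=
  exists c d, 0 <= c /\ sphere_sos d (c%:MP - p ^+ 2).

Lemma sphere_boundedC c : sphere_bounded c%:MP.
Proof.
exists (c ^+ 2), 0; split; first exact: sqr_ge0.
by rewrite -rmorphXn /= subrr -mpolyC0; exact: sphere_sosC.
Qed.

Lemma sphere_boundedX i : sphere_bounded 'X_i.
Proof.
exists (rho ^+ 2), 1; split; first exact: sqr_ge0.
apply: (@sphere_sos_eq _ (\sum_(j | j != i) 'X_j ^+ 2)); last first.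
  rewrite -big_filter; apply: sphere_sos_sum => j.
  by apply: sphere_sos_sqr; rewrite msizeX mdeg1.
move=> v vS; rewrite mevalB mevalC -vS [in RHS](bigD1 i)//= rmorphXn /= mevalXU.
rewrite [RHS]addrC addKr (raddf_sum (meval v)) /=; apply: eq_bigr => j _.
by rewrite rmorphXn /= mevalXU.
Qed.

Lemma sphere_boundedD p q :
  sphere_bounded p -> sphere_bounded q -> sphere_bounded (p + q).
Proof.
move=> [c [d [c0 cp]]] [c' [d' [c'0 cq]]].
pose e := maxn (maxn d d') (msize (p - q)).
exists (2 * (c + c')), e; split; first by rewrite mulr_ge0 ?addr_ge0.
have -> : (2 * (c + c'))%:MP - (p + q) ^+ 2 =
    2 *: (c%:MP - p ^+ 2) + 2 *: (c'%:MP - q ^+ 2) + (p - q) ^+ 2.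
  by rewrite mpolyCM mpolyCD -!mul_mpolyC; ring.
apply: sphere_sosD; first apply: sphere_sosD.
- by apply: sphere_sosZ => //; apply: sphere_sosW cp; rewrite /e !leq_max leqnn.
- by apply: sphere_sosZ => //; apply: sphere_sosW cq; rewrite /e !leq_max leqnn orbT.
- by apply: sphere_sos_sqr; rewrite leqW// leq_maxr.
Qed.

Lemma sphere_boundedM p q :
  sphere_bounded p -> sphere_bounded q -> sphere_bounded (p * q).
Proof.
move=> [c [d [c0 cp]]] [c' [d' [c'0 cq]]].
exists (c * c'), (d + msize q + d')%N; split; first exact: mulr_ge0.
have -> : (c * c')%:MP - (p * q) ^+ 2 =
    (c%:MP - p ^+ 2) * q ^+ 2 + c *: (c'%:MP - q ^+ 2).
  by rewrite mpolyCM -mul_mpolyC; ring.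
apply: sphere_sosD.
  by apply: (@sphere_sosW (d + msize q)); [rewrite leq_addr|exact: sphere_sosM_sqr].
by apply: sphere_sosZ => //; apply: sphere_sosW cq; rewrite leq_addl.
Qed.

Lemma sphere_boundedP p : sphere_bounded p.
Proof.
move: p; apply: mpoly_ring_ind => [c|i|p q|p q].
- exact: sphere_boundedC.
- exact: sphere_boundedX.
- exact: sphere_boundedD.
- exact: sphere_boundedM.
Qed.

(* [c - e p = ((1 - e p)^2 + (c' - p^2)) / 2] for [e = 1, -1] and [c' = 2 c - 1]. *)
Lemma sphere_archimedean p : exists c d, 0 <= c /\
  forall e : bool, sphere_sos d (c%:MP - (-1) ^+ e *: p).
Proof.
have [c [d [c0 cp]]] := sphere_boundedP p.
exists ((1 + c) / 2), (maxn d (msize p)); split=> [|e].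
  by rewrite divr_ge0// addr_ge0.
have -> : ((1 + c) / 2)%:MP - (-1) ^+ e *: p =
    2^-1 *: ((1 - (-1) ^+ e *: p) ^+ 2 + (c%:MP - p ^+ 2)).
  rewrite mulrC mpolyCM mpolyCD mpolyC1 -!mul_mpolyC.
  have -> : 2^-1%:MP * ((1 - ((-1) ^+ e)%:MP * p) ^+ 2 + (c%:MP - p ^+ 2)) =
    2^-1%:MP * (1 + c%:MP) + 2^-1%:MP * ((((-1) ^+ e)%:MP) ^+ 2 - 1) * p ^+ 2
    - (2^-1%:MP * 2%:MP) * ((-1) ^+ e)%:MP * p.
    by rewrite [2%:MP]mpolyC_nat; ring.
  rewrite -rmorphXn /= sqrr_sign -!mpolyCM mulVf ?pnatr_eq0//.
  by rewrite mpolyC1 subrr mulr0 mul0r addr0 mul1r.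
apply: sphere_sosZ; first by rewrite invr_ge0.
apply: sphere_sosD; last by apply: sphere_sosW cp; rewrite leq_maxl.
apply: sphere_sos_sqr; apply: msizeD_leq; first by rewrite msize1.
rewrite msizeN (leq_trans (msizeZ_le _ _))//.
by rewrite leqW// leq_maxr.
Qed.

End SphereSOS.

(** * Sums of squares from positive semidefinite forms *)

Section GramSchmidt.
Context {K : realType} {n : nat} {V : lmodType K}.
Variables (B : V -> V -> K).
Hypotheses (B_linear : forall u (a : K) w w', B u (a *: w + w') = a * B u w + B u w')
  (B_sym : forall u w, B u w = B w u) (B_ge0 : forall w, 0 <= B w w).

Let B_linearl u (a : K) w w' : B (a *: w + w') u = a * B w u + B w' u.
Proof. by rewrite B_sym B_linear !(B_sym u). Qed.

Lemma psd_form_kernel u w : B u u = 0 -> B u w = 0.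
Proof.
move=> uu0; apply/eqP/negPn/negP => uw0.
(* The coefficient is chosen so that the form takes the value -1 at this vector. *)
have := B_ge0 ((- (B w w + 1) / (2 * B u w)) *: u + w).
rewrite B_linear !B_linearl uu0 mulr0 add0r -(B_sym u w).
suff -> : - (B w w + 1) / (2 * B u w) * B u w +
  (- (B w w + 1) / (2 * B u w) * B u w + B w w) = -1 by rewrite oppr_ge0 ler10.
by field.
Qed.

(* Gram-Schmidt on the second components of the tensor [sum u_i (x) w_i]; when
   [B w w = 0] the coefficients [B w w_i / B w w] are all [0 / 0 = 0]. *)
Lemma psd_form_sos d (s : seq ({mpoly K[n]} * V)) :
  all (fun t => msize t.1 <= d)%N s ->
  exists2 r : seq {mpoly K[n]}, all (fun q => msize q <= d)%N r &
    \sum_(t <- s) \sum_(t' <- s) B t.2 t'.2 *: (t.1 * t'.1) = \sum_(q <- r) q ^+ 2.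
Proof.
move sz : (size s) => k; elim: k s sz => [|k IHk] [|[u w] s]//=.
  by move=> _ _; exists [::]; rewrite // !big_nil.
move=> [ks] /andP[ud sd]; pose c := B w w; pose a x := B w x / c.
have cE x : B w x = c * a x.
  have [c0|c0] := eqVneq c 0; first by rewrite c0 mul0r psd_form_kernel.
  by rewrite /a mulrC divfK.
pose T := \sum_(t <- s) a t.2 *: t.1.
have [||r rd rE] := IHk [seq (t.1, - a t.2 *: w + t.2) | t <- s].
- by rewrite size_map.
- by rewrite all_map.
exists (Num.sqrt c *: (u + T) :: r) => /=.
  rewrite rd andbT (leq_trans (msizeZ_le _ _))//; apply: msizeD_leq => //.
  rewrite /T big_seq; apply: (big_ind (fun q => msize q <= d)%N).
  - by rewrite msize0.
  - by move=> p q; exact: msizeD_leq.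
  - by move=> t /(allP sd); apply: leq_trans; exact: msizeZ_le.
rewrite !big_cons -rE !big_map /= exprZn sqr_sqrtr ?B_ge0// => {r rd rE}.
(* Clearing [w] from the second components costs exactly [c T^2], the term that completes the square
   [c (u + T)^2]. *)
have -> : \sum_(t <- s) \sum_(t' <- [seq (t0.1, - a t0.2 *: w + t0.2) | t0 <- s])
    B (- a t.2 *: w + t.2) t'.2 *: (t.1 * t'.1) =
    \sum_(t <- s) \sum_(t' <- s) B t.2 t'.2 *: (t.1 * t'.1) - c *: T ^+ 2.
  rewrite expr2 /T mulr_suml scaler_sumr -sumrB; apply: eq_bigr => t _.
  rewrite big_map mulr_sumr scaler_sumr -sumrB; apply: eq_bigr => t' _ /=.
  rewrite B_linearl !B_linear -/c (B_sym _ w) !cE.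
  rewrite -[_ * (a t'.2 *: _)]scalerAr -scalerAl !scalerA -scalerBl.
  by congr (_ *: _); ring.
have -> : \sum_(t <- s) \sum_(t' <- (u, w) :: s) B t.2 t'.2 *: (t.1 * t'.1) =
    c *: (T * u) + \sum_(t <- s) \sum_(t' <- s) B t.2 t'.2 *: (t.1 * t'.1).
  under eq_bigr do rewrite big_cons.
  rewrite big_split /=; congr (_ + _); rewrite /T mulr_suml scaler_sumr.
  by apply: eq_bigr => t _; rewrite B_sym cE -scalerAl scalerA.
have -> : \sum_(t <- s) B w t.2 *: (u * t.1) = c *: (u * T).
  rewrite /T mulr_sumr scaler_sumr; apply: eq_bigr => t _.
  by rewrite cE -[_ * (a _ *: _)]scalerAr scalerA.
rewrite -!mul_mpolyC; ring.
Qed.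

End GramSchmidt.

(** * Moments of the height function *)

Section ZonalMean.
Context {K : realType} {n : nat}.
Implicit Types (p q : {mpoly K[n]}) (m : 'X_{1..n}) (h : {poly K})
  (v : 'I_n -> K).
Hypothesis n_gt0 : (0 < n)%N.

(** The moments of one coordinate of a uniform point on the unit sphere, that is, of the height over
    any pole. *)
Definition zonal_moment k : K := gauss_moment k / @radial_moment K n k.

Lemma zonal_momentSS k :
  (n + k)%:R * zonal_moment k.+2 = k.+1%:R * zonal_moment k.
Proof.
rewrite /zonal_moment /=.
have := lt0r_neq0 (@radial_moment_gt0 K n n_gt0 k); move: (radial_moment k) => z z0.
have nk0 : (n + k)%:R != 0 :> K by rewrite pnatr_eq0 addn_eq0 -leqn0 leqNgt n_gt0.
by move: (n + k)%:R (k.+1%:R) nk0 => a b a0; field; rewrite a0 z0.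
Qed.

Fact zonal_key : unit. Proof. exact: tt. Qed.

Definition zonal_mean : {poly K} -> K :=
  locked_with zonal_key (fun h => \sum_(i < size h) h`_i * zonal_moment i).

Lemma zonal_meanwE k h : (size h <= k)%N ->
  zonal_mean h = \sum_(i < k) h`_i * zonal_moment i.
Proof.
move=> hk; rewrite /zonal_mean unlock (big_ord_widen _ (fun i => h`_i * zonal_moment i) hk).
rewrite big_mkcond /=; apply: eq_bigr => i _; case: ltnP => // hi.
by rewrite nth_default ?mul0r.
Qed.

Lemma zonal_mean_is_linear : linear_for *%R zonal_mean.
Proof.
move=> c h1 h2; pose k := maxn (size h1) (size h2).
have h1k : (size h1 <= k)%N by rewrite leq_maxl.
have h2k : (size h2 <= k)%N by rewrite leq_maxr.
have hk : (size (c *: h1 + h2)%R <= k)%N.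
  rewrite (leq_trans (size_polyD _ _))// geq_max; apply/andP; split=> //.
  by apply: leq_trans h1k; exact: size_scale_leq.
rewrite !(zonal_meanwE h1k, zonal_meanwE h2k, zonal_meanwE hk) mulr_sumr -big_split /=.
by apply: eq_bigr => i _; rewrite coefD coefZ mulrDl mulrA.
Qed.

HB.instance Definition _ :=
  GRing.isLinear.Build K {poly K} K *%R zonal_mean zonal_mean_is_linear.

Lemma zonal_meanXn k : zonal_mean 'X^k = zonal_moment k.
Proof.
rewrite (@zonal_meanwE k.+1) ?size_polyXn// big_ord_recr big1 /=.
  by rewrite coefXn eqxx mul1r add0r.
by move=> i _; rewrite coefXn ltn_eqF// mul0r.
Qed.

Lemma zonal_mean_odd k : odd k -> zonal_moment k = 0.
Proof. by move=> ok; rewrite /zonal_moment gauss_moment_odd// mul0r. Qed.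

Definition zonal_mean2 e j : K := zonal_mean ('X^e * (1 - 'X^2) ^+ j).

Lemma zonal_mean2S e j :
  zonal_mean2 e j.+1 = zonal_mean2 e j - zonal_mean2 e.+2 j.
Proof.
rewrite /zonal_mean2 -linearB /=; congr zonal_mean.
by rewrite exprS -[e.+2]addn2 exprD; ring.
Qed.

(** What integration by parts would give for the density proportional to [(1 - t^2)^((n - 3) / 2)]
    of the height. *)
Lemma zonal_mean2_moment e j :
  (e + n + j.*2)%:R * zonal_mean2 e.+2 j = e.+1%:R * zonal_mean2 e j.
Proof.
elim: j e => [|j IHj] e.
  by rewrite addn0 /zonal_mean2 !expr0 !mulr1 !zonal_meanXn addnC zonal_momentSS.
rewrite !zonal_mean2S !mulrBr.
have -> : (e + n + j.+1.*2)%N = (e.+2 + n + j.*2)%N by lia.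
rewrite (IHj e.+2) -(IHj e).
have -> : (e.+2 + n + j.*2)%N = (e + n + j.*2 + 2)%N by lia.
have -> : e.+3 = (e.+1 + 2)%N by lia.
by rewrite !natrD; ring.
Qed.

Hypothesis n_gt1 : (1 < n)%N.

Lemma zonal_mean2_shift e j :
  zonal_mean2 e j = (e + n + j.*2)%:R / (n + j.*2 - 1)%:R * zonal_mean2 e j.+1.
Proof.
have := zonal_mean2_moment e j; rewrite [zonal_mean2 e j.+1]zonal_mean2S.
have -> : (e + n + j.*2)%N = (e.+1 + (n + j.*2 - 1))%N by move: n_gt1; lia.
have : (n + j.*2 - 1)%:R != 0 :> K by rewrite pnatr_eq0 -lt0n; move: n_gt1; lia.
rewrite natrD; move: (n + j.*2 - 1)%:R (e.+1%:R) => a b a0 H.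
rewrite mulrAC; apply: (canRL (mulfK a0)).
by rewrite mulrBr H; ring.
Qed.

(* The factor [e] on the left absorbs the truncated subtraction [e - 1]. *)
Lemma zonal_mean2_raise e d j : (j.*2 <= d)%N ->
  e%:R * zonal_mean2 (e.-1 + d - j.*2) j = (n + (e + d) - 1)%:R *
   (zonal_mean2 (e + d.+1 - j.*2) j -
    (d - j.*2)%:R / (n + j.*2 - 1)%:R * zonal_mean2 (e + d.+1 - j.+1.*2) j.+1).
Proof.
move=> jd; have a0 : (n + j.*2 - 1)%:R != 0 :> K.
  by rewrite pnatr_eq0 -lt0n; move: n_gt1; lia.
have [/eqP|] := posnP (e + d - j.*2).
  rewrite subn_eq0 => ejd.
  have -> : e = 0%N by lia.
  have -> : (d - j.*2 = 0)%N by lia.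
  have -> : (0 + d.+1 - j.*2 = 1)%N by lia.
  rewrite !mul0r subr0 (_ : zonal_mean2 1 j = 0) ?mulr0//.
  elim: (j) (1%N) (isT : odd 1) => [|j' IHj] k ok.
    by rewrite /zonal_mean2 expr0 mulr1 zonal_meanXn zonal_mean_odd.
  by rewrite zonal_mean2S !IHj ?subrr//= negbK.
case E: (e + d - j.*2)%N => [//|k] _.
have -> : (e + d.+1 - j.*2)%N = k.+2 by lia.
have -> : (e + d.+1 - j.+1.*2)%N = k by lia.
have -> : e%:R * zonal_mean2 (e.-1 + d - j.*2) j = e%:R * zonal_mean2 k j.
  by case: e E => [|e] E; [rewrite !mul0r|congr (_ * zonal_mean2 _ _); lia].
have nE : (n + (e + d) - 1 = k + n + j.*2)%N by lia.
rewrite nE mulrBr zonal_mean2_moment.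
have -> : (k + n + j.*2)%:R * ((d - j.*2)%:R / (n + j.*2 - 1)%:R * zonal_mean2 k j.+1)
  = (d - j.*2)%:R * zonal_mean2 k j by rewrite [in RHS]zonal_mean2_shift; ring.
by rewrite -mulrBl -natrB; [congr (_%:R * _); lia|lia].
Qed.

Lemma zonal_mean2_down e d j : (j.*2 < d)%N ->
  zonal_mean2 (e + d.-1 - j.*2) j = (n + (e + d) - 1)%:R *
   ((n + j.*2 - 1)%:R^-1 * zonal_mean2 (e + d.+1 - j.+1.*2) j.+1).
Proof.
move=> jd; rewrite zonal_mean2_shift mulrA; congr (_%:R / _ * zonal_mean2 _ _); lia.
Qed.

End ZonalMean.

(** * Averages over parallels *)

Section FunkHecke.
Context {K : realType} {n : nat}.
Implicit Types (p q : {mpoly K[n]}) (m : 'X_{1..n}) (h : {poly K})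
  (v : 'I_n -> K).
Hypothesis n_gt0 : (0 < n)%N.
Variable rho : K.
Hypothesis rho_gt0 : 0 < rho.

Local Notation L := (sphere_mean rho).
Local Notation mu := (@zonal_mean K n).
Local Notation nu := (@zonal_mean2 K n).
Local Notation zmom := (@zonal_moment K n).

Let rho_neq0 : rho != 0 := lt0r_neq0 rho_gt0.

(** The height over the pole [v], normalised to be 1 at [v] when [v] lies on the sphere. *)
Definition zonal_form v : {mpoly K[n]} := \sum_(i < n) (v i / rho ^+ 2) *: 'X_i.

Definition zonal v h : {mpoly K[n]} := horner_alg (zonal_form v) h.

Lemma zonal_form_homog v : zonal_form v \is 1.-homog.
Proof. by apply: rpred_sum => i _; apply: dhomogZ; rewrite dhomogX /= mdeg1. Qed.

Lemma zonal_formX_homog v e : zonal_form v ^+ e \is e.-homog.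
Proof. by have := dhomogMn e (zonal_form_homog v); rewrite mul1n. Qed.

Lemma mderiv_zonal_form v i : (zonal_form v)^`M(i) = (v i / rho ^+ 2)%:MP.
Proof.
rewrite /zonal_form (linear_sum (mderiv i)) /= (bigD1 i)//= big1 ?addr0.
  rewrite mderivZ mderivX mnm1E eqxx scale1r.
  have -> : (U_(i) - U_(i) = 0 :> 'X_{1..n})%MM.
    by apply/mnmP => k; rewrite mnmBE subnn mnm0E.
  by rewrite mpolyX0 -mul_mpolyC mulr1.
by move=> j /negPf ji; rewrite mderivZ mderivX mnm1E ji scale0r scaler0.
Qed.

Lemma mderiv_zonal_formX v i e : (zonal_form v ^+ e)^`M(i) =
  (e%:R * (v i / rho ^+ 2)) *: zonal_form v ^+ e.-1.
Proof.
elim: e => [|e IHe]; first by rewrite expr0 -mpolyC1 mderivC mul0r scale0r.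
rewrite exprS mderivM IHe mderiv_zonal_form mul_mpolyC -scalerAr.
case: e {IHe} => [|e] /=; first by rewrite !mul0r scale0r addr0 mul1r.
by rewrite -exprS -scalerDl -[e.+2%:R]natr1; congr (_ *: _); ring.
Qed.

(** Takes the place of rotation invariance: integration by parts gives the recursion of
    [zonal_moment], and [v] enters only through its norm. *)
Lemma sphere_mean_zonal_formX v k : on_sphere rho v ->
  L (zonal_form v ^+ k) = zmom k.
Proof.
move=> vS; elim/ltn_ind: k => -[|[|k]] IHk.
- rewrite expr0 -(mpolyX0 n K) /sphere_mean mlinX /sphere_moment mdeg0 expr0 mul1r.
  by rewrite big1 => [|i _]; rewrite ?mnm0E.
- rewrite expr1 (sphere_mean_odd _ _ (zonal_form_homog v))//.
  by rewrite zonal_mean_odd.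
have nk0 : (n + k)%:R != 0 :> K by rewrite pnatr_eq0 -lt0n addn_gt0 n_gt0.
apply: (mulfI nk0); rewrite zonal_momentSS// -IHk//.
rewrite exprS {1}/zonal_form mulr_suml (linear_sum L) /= mulr_sumr.
transitivity (\sum_(i < n) (v i ^+ 2 / rho ^+ 2) * (k.+1%:R * L (zonal_form v ^+ k))).
  apply: eq_bigr => i _; rewrite -scalerAl linearZ /= mulrCA.
  have := sphere_mean_deriv n_gt0 rho i (zonal_formX_homog v k.+1).
  rewrite addnS -natr1 addrK => ->; rewrite mderiv_zonal_formX linearZ /=; field.
  by [].
by rewrite -!mulr_suml vS divff ?mul1r// sqrf_eq0.
Qed.

Lemma zonal_coef v h : zonal v h = \sum_(e < size h) h`_e *: zonal_form v ^+ e.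
Proof.
rewrite -[in LHS](coefK h) poly_def /zonal (linear_sum (horner_alg _)) /=.
apply: eq_bigr => e _.
by rewrite -mul_polyC rmorphM /= rmorphXn /= horner_algX horner_algC mulr_algl.
Qed.

Lemma sphere_mean_zonal v h : on_sphere rho v -> L (zonal v h) = mu h.
Proof.
move=> vS; rewrite zonal_coef (linear_sum L) /= (zonal_meanwE (leqnn _)).
by apply: eq_bigr => e _; rewrite linearZ /= sphere_mean_zonal_formX.
Qed.

Hypothesis n_gt1 : (1 < n)%N.

(** A point at height [t] over [v] is [t v] plus an orthogonal part of length proportional to
    [sqrt (1 - t^2)]. Averaging a monomial over that part kills its odd powers, which leaves
    [t^(d - 2 j) (1 - t^2)^j] times a function of [v]. The [b j] do not depend on [e], so the
    formula extends to every kernel. *)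
Lemma sphere_mean_zonal_monomial d m : mdeg m = d ->
  exists b : nat -> {mpoly K[n]}, [/\ b 0 = 'X_[m],
    (forall j, (d < j.*2)%N -> b j = 0) &
    forall v e, on_sphere rho v -> L (zonal_form v ^+ e * 'X_[m]) =
      \sum_(j < d.+1) nu (e + d - j.*2) j * (b j).@[v]].
Proof.
elim/ltn_ind: d m => -[|d] IHd m degm.
  exists (fun j => if j is 0 then 1 else 0); split.
  - by move/eqP: degm; rewrite mdeg_eq0 => /eqP ->; rewrite mpolyX0.
  - by case.
  move=> v e vS; move/eqP: degm; rewrite mdeg_eq0 => /eqP ->.
  rewrite mpolyX0 mulr1 big_ord1 meval1 mulr1 sphere_mean_zonal_formX//.
  by rewrite /zonal_mean2 expr0 mulr1 zonal_meanXn addn0 subn0.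
have [i mi] : exists i, m i != 0%N.
  have [i mi|m0] := pickP (fun i => m i != 0%N); first by exists i.
  by move: degm; rewrite mdegE big1// => i _; apply/eqP/negPn; rewrite m0.
pose m' := (m - U_(i))%MM.
have mE : m = (U_(i) + m')%MM by rewrite addmC submK// lep1mP.
have degm' : mdeg m' = d by move: degm; rewrite mE mdegD mdeg1 => -[].
have [b [b0 bd bE]] := IHd d (ltnSn d) m' degm'.
(* The expansion of the derivative of ['X_[m']]. If [m' i = 0] the truncated [m' - U_(i)] has the
   wrong degree, but its coefficient is 0 and [b' = 0] will do. *)
have [b' [b'd b'E]] : exists b' : nat -> {mpoly K[n]},
    (forall j, (d <= j.*2)%N -> b' j = 0) /\
    forall v e, on_sphere rho v ->
      (m' i)%:R * L (zonal_form v ^+ e * 'X_[m' - U_(i)]) =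
      \sum_(j < d) nu (e + d.-1 - j.*2) j * (b' j).@[v].
  have [m'i|m'i] := eqVneq (m' i) 0%N.
    exists (fun=> 0); split=> // v e vS; rewrite m'i mul0r big1// => j _.
    by rewrite meval0 mulr0.
  have m'E : (m' - U_(i) + U_(i))%MM = m' by rewrite submK// lep1mP.
  have degm'' : (mdeg (m' - U_(i))%MM).+1 = d by rewrite -addn1 -(mdeg1 i) -mdegD m'E.
  have [|c [_ cd cE]] := IHd _ _ (m' - U_(i))%MM erefl; first by lia.
  exists (fun j => (m' i)%:R *: c j); split.
    by move=> j dj; rewrite cd ?scaler0//; lia.
  move=> v e vS; rewrite cE// -degm'' /= mulr_sumr.
  by apply: eq_bigr => j _; rewrite mevalZ mulrCA.
pose w j : K := (n + j.*2 - 1)%:R^-1.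
(* Read off from the integration by parts: [zonal_mean2_raise] and [zonal_mean2_down] extract the
   common factor [n + (e + d) - 1], and their [j.+1] terms move to the next index. *)
exists (fun j => 'X_i * b j + if j is j'.+1 then
  (rho ^+ 2 * w j') *: b' j' - ((d - j'.*2)%:R * w j') *: ('X_i * b j') else 0).
split.
- by rewrite b0 addr0 -mpolyXD -mE.
- move=> [|j] // dj; rewrite bd; last by lia.
  rewrite mulr0 add0r b'd; last by lia.
  rewrite scaler0 add0r; have [dj'|dj'] := ltnP d j.*2.
    by rewrite bd// mulr0 scaler0 oppr0.
  by rewrite (_ : (d - j.*2 = 0)%N) ?mul0r ?scale0r ?oppr0//; lia.
move=> v e vS; have Nn0 : (n + (e + d) - 1)%:R != 0 :> K.
  by rewrite pnatr_eq0 -lt0n; move: n_gt1; lia.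
apply: (mulfI Nn0).
have -> : (n + (e + d) - 1)%:R * L (zonal_form v ^+ e * 'X_[m]) =
   e%:R * v i * L (zonal_form v ^+ e.-1 * 'X_[m']) +
   rho ^+ 2 * ((m' i)%:R * L (zonal_form v ^+ e * 'X_[m' - U_(i)])).
  have hom : zonal_form v ^+ e * 'X_[m'] \is (e + d).-homog.
    by apply: dhomogM; [exact: zonal_formX_homog|rewrite dhomogX /= degm'].
  have := sphere_mean_deriv n_gt0 rho i hom.
  rewrite mE mpolyXD mulrCA natrB ?addn_gt0 ?n_gt0// => ->.
  have -> : (zonal_form v ^+ e * 'X_[m'])^`M(i) =
      (e%:R * (v i / rho ^+ 2)) *: (zonal_form v ^+ e.-1 * 'X_[m']) +
      (m' i)%:R *: (zonal_form v ^+ e * 'X_[m' - U_(i)]).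
    by rewrite mderivM mderiv_zonal_formX mderivX -!mul_mpolyC; ring.
  by rewrite linearD !linearZ /=; field.
rewrite b'E// bE// !mulr_sumr.
under [RHS]eq_bigr do rewrite mevalD mulrDr mulrDr.
rewrite big_split /= [X in _ = X + _]big_ord_recr [X in _ = _ + X]big_ord_recl /=.
rewrite (bd d.+1) ?mulr0 ?meval0 ?mulr0 ?addr0 ?add0r; last by lia.
rewrite [X in _ + X = _](_ : _ = \sum_(j < d.+1) rho ^+ 2 *
   (nu (e + d.-1 - j.*2) j * (b' j).@[v])); last first.
  by rewrite big_ord_recr /= b'd ?meval0 ?mulr0 ?addr0//; lia.
rewrite -!big_split /=; apply: eq_bigr => -[j /= _] _; rewrite /bump add1n.
rewrite mevalB !mevalZ mevalM mevalXU.
have -> : rho ^+ 2 * (nu (e + d.-1 - j.*2) j * (b' j).@[v]) =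
  rho ^+ 2 * ((n + (e + d) - 1)%:R * (w j * nu (e + d.+1 - j.+1.*2) j.+1) * (b' j).@[v]).
  have [dj|jd] := leqP d j.*2; first by rewrite b'd// meval0 !mulr0.
  by rewrite zonal_mean2_down.
have -> : e%:R * v i * (nu (e.-1 + d - j.*2) j * (b j).@[v]) =
  (n + (e + d) - 1)%:R * (nu (e + d.+1 - j.*2) j -
    (d - j.*2)%:R * w j * nu (e + d.+1 - j.+1.*2) j.+1) * v i * (b j).@[v].
  have [dj|jd] := ltnP d j.*2; first by rewrite bd// meval0 !mulr0.
  by rewrite -zonal_mean2_raise//; ring.
ring.
Qed.

(* A Funk-Hecke formula: the average of [p] over the parallel of height [t]
   around [v] is [sum_l a_l(t) b_l(v)], which is [p(v)] at [t = 1]. *)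
Lemma sphere_mean_zonalM p : exists s : seq ({poly K} * {mpoly K[n]}),
  forall v, on_sphere rho v ->
    (forall h, L (zonal v h * p) = \sum_(t <- s) mu (h * t.1) * t.2.@[v]) /\
    p.@[v] = \sum_(t <- s) t.1.[1] * t.2.@[v].
Proof.
pose rep p := exists s : seq ({poly K} * {mpoly K[n]}),
  forall v, on_sphere rho v ->
    (forall h, L (zonal v h * p) = \sum_(t <- s) mu (h * t.1) * t.2.@[v]) /\
    p.@[v] = \sum_(t <- s) t.1.[1] * t.2.@[v].
rewrite [p]mpolyE; apply: (big_ind rep).
- exists [::] => v vS; split=> [h|]; first by rewrite big_nil mulr0 linear0.
  by rewrite big_nil meval0.
- move=> q r [s sE] [s' s'E]; exists (s ++ s') => v vS.
  have [sL sp] := sE v vS; have [s'L s'p] := s'E v vS.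
  split=> [h|]; last by rewrite mevalD big_cat sp s'p.
  by rewrite mulrDr linearD /= sL s'L big_cat.
move=> m _; have [b [b0 bd bE]] := sphere_mean_zonal_monomial (erefl (mdeg m)).
set d := mdeg m in bd bE.
exists [seq ('X^(d - j.*2) * (1 - 'X^2) ^+ j, p@_m *: b j) | j <- index_iota 0 d.+1].
move=> v vS; split=> [h|]; rewrite big_map big_mkord.
  rewrite -scalerAr linearZ /= zonal_coef mulr_suml (linear_sum L) /=.
  transitivity (p@_m * \sum_(e < size h) h`_e *
      \sum_(j < d.+1) nu (e + d - j.*2) j * (b j).@[v]).
    by congr (_ * _); apply: eq_bigr => e _; rewrite -scalerAl linearZ /= bE.
  rewrite mulr_sumr.
  under [LHS]eq_bigr do rewrite mulrA mulr_sumr.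
  rewrite exchange_big /=; apply: eq_bigr => j _; rewrite mevalZ.
  have [dj|jd] := ltnP d j.*2.
    by rewrite bd// meval0 !mulr0 big1// => e _; rewrite !mulr0.
  rewrite -[in RHS](coefK h) poly_def mulr_suml (linear_sum mu) /= mulr_suml.
  apply: eq_bigr => e _; rewrite -[_ *: 'X^_ * _]scalerAl linearZ /= [X in zonal_mean X]mulrA -exprD.
  by rewrite addnBA// -/(nu _ _); ring.
rewrite big_ord_recl big1 => [|j _].
  by rewrite b0 subn0 mulr1 hornerXn expr1n mul1r addr0.
rewrite /= hornerM !horner_exp hornerD hornerN hornerC horner_exp hornerX !expr1n.
by rewrite subrr expr0n mulr0 mul0r.
Qed.

End FunkHecke.

(** * Gegenbauer polynomials *)

Section Gegenbauer.
Context {K : realType} {d : nat}.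
Local Notation n := d.+2.
Local Notation mu := (@zonal_mean K n).

Definition gweight j : K := 'C(j + d, d)%:R.
Definition gweight_pred j : K := if j is j'.+1 then gweight j' else 0.
(** The dimension of the space of spherical harmonics of degree [j] in [d + 2] variables. *)
Definition gnorm j : K := gweight j + gweight_pred j.

(** Normalised to be 1 at 1: Chebyshev polynomials for [d = 0], Legendre polynomials for [d = 1]. *)
Fixpoint gegenbauer j : {poly K} :=
  match j with
  | 0 => 1
  | j'.+1 => (gweight j')^-1 *: (gnorm j' *: ('X * gegenbauer j') -
      gweight_pred j' *: if j' is j''.+1 then gegenbauer j'' else 0)
  end.

Arguments gegenbauer : simpl never.

Lemma gweight_gt0 j : 0 < gweight j.
Proof. by rewrite ltr0n bin_gt0 leq_addl. Qed.

Lemma gweight_pred_ge0 j : 0 <= gweight_pred j.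
Proof. by case: j => //= j; exact/ltW/gweight_gt0. Qed.

Lemma gnorm_gt0 j : 0 < gnorm j.
Proof. by rewrite ltr_wpDr ?gweight_gt0// gweight_pred_ge0. Qed.

Lemma gweightS j : j.+1%:R * gweight j.+1 = (j + d).+1%:R * gweight j.
Proof.
rewrite -!natrM; congr (_%:R); have := mul_bin_down (j + d).+1 d; rewrite /= => ->.
by rewrite addSn subSn ?leq_addl// addnK.
Qed.

Lemma gegenbauer_rec j : gnorm j *: ('X * gegenbauer j) =
  gweight j *: gegenbauer j.+1 + gweight_pred j *: gegenbauer j.-1.
Proof.
rewrite [gegenbauer j.+1]/gegenbauer -/gegenbauer scalerA divff ?lt0r_neq0 ?gweight_gt0// scale1r.
by case: j => [|j] /=; rewrite ?scale0r ?subr0 ?addr0 ?subrK.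
Qed.

Lemma size_gegenbauer j : (size (gegenbauer j) <= j.+1)%N.
Proof.
elim/ltn_ind: j => -[|j] IHj; first by rewrite size_poly1.
rewrite /gegenbauer -/gegenbauer (leq_trans (size_scale_leq _ _))//.
rewrite (leq_trans (size_polyD _ _))// geq_max size_polyN.
apply/andP; split; rewrite (leq_trans (size_scale_leq _ _))//.
  rewrite (leq_trans (size_polyMleq _ _))// size_polyX.
  by have := IHj j (ltnSn j); move: (size _) => z; lia.
case: j IHj => [|j] IHj; first by rewrite size_poly0.
by apply: leq_trans (IHj j _) _; lia.
Qed.

Fixpoint dfact (k : nat) : nat :=
  if k is k'.+2 then k * dfact k' else 1.

Lemma dfact_gt0 k : (0 < dfact k)%N.
Proof. by elim/ltn_ind: k => -[|[|k]] IHk //=; rewrite muln_gt0 IHk. Qed.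

Lemma gauss_moment_even k : ~~ odd k -> gauss_moment k = k`!%:R / (dfact k)%:R :> K.
Proof.
elim/ltn_ind: k => -[|[|k]] IHk //=; first by rewrite divr1.
rewrite negbK => ek; rewrite IHk// !factS !natrM.
have : (dfact k)%:R != 0 :> K by rewrite pnatr_eq0 -lt0n dfact_gt0.
have : k.+2%:R != 0 :> K by rewrite pnatr_eq0.
by move: (dfact k)%:R k.+2%:R => a b b0 a0; field; rewrite a0 b0.
Qed.

Lemma dfactSS k : dfact k.+2 = (k.+2 * dfact k)%N. Proof. by []. Qed.

Let rad k : K := @radial_moment K n k.

Let rad_neq0 k : rad k != 0.
Proof. by apply/lt0r_neq0/radial_moment_gt0. Qed.

Let ratio j m : K := (j + m)`!%:R / ((dfact m)%:R * rad (j.*2 + m)).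

Let radSS k : rad k.+2 = (n + k)%:R * rad k. Proof. by []. Qed.

Let dfact_neq0 k : (dfact k)%:R != 0 :> K.
Proof. by rewrite pnatr_eq0 -lt0n dfact_gt0. Qed.

Lemma zonal_mean_gegenbauerM j :
  (forall i, (i < j)%N -> mu ('X^i * gegenbauer j) = 0) /\
  (forall m, mu ('X^(j + m) * gegenbauer j) = if odd m then 0 else ratio j m).
Proof.
elim/ltn_ind: j => -[|j] IHj.
  split=> // m; rewrite mulr1 zonal_meanXn add0n /zonal_moment.
  have [om|em] := boolP (odd m); first by rewrite gauss_moment_odd// mul0r.
  by rewrite gauss_moment_even// /ratio invfM mulrA.
have e0 : gweight j != 0 by rewrite lt0r_neq0 ?gweight_gt0.
have rec i : mu ('X^i * gegenbauer j.+1) = (gweight j)^-1 *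
    (gnorm j * mu ('X^(i.+1) * gegenbauer j) -
     gweight_pred j * mu ('X^i * gegenbauer j.-1)).
  apply: (canRL (mulKf e0)).
  have /(congr1 (fun h => mu ('X^i * h))) := gegenbauer_rec j.
  have muZ (c : K) p : mu ('X^i * (c *: p)) = c * mu ('X^i * p).
    by rewrite -[_ * (c *: p)]scalerAr linearZ.
  by rewrite mulrDr linearD /= !muZ mulrA -exprSr => ->; rewrite addrK.
have [lt0 ge0] := IHj j (ltnSn j).
have nj0 : (n + j.*2)%:R != 0 :> K by rewrite pnatr_eq0.
case: j => [|j] in IHj e0 rec lt0 ge0 nj0 *.
  split=> [[|//] _|m].
    rewrite rec (_ : 1%N = 0 + 1)%N// ge0/= mulr0 mul0r subr0 mulr0//.
  rewrite rec {1}/gweight_pred mul0r subr0 /gnorm /gweight_pred addr0 mulKf//.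
  rewrite (_ : (1 + m).+1 = 0 + m.+2)%N// ge0 /= negbK; case: ifP => // om.
  rewrite /ratio !add0n add1n dfactSS [m.+2`!]factS !natrM.
  have : m.+2%:R != 0 :> K by rewrite pnatr_eq0.
  have := dfact_neq0 m; have := rad_neq0 m.+2.
  move: (rad _) (dfact m)%:R m.+2%:R => a b c a0 b0 c0; field.
  by rewrite a0 b0 c0.
have [lt1 ge1] := IHj j (ltnW (ltnSn _)).
pose a : K := (j + d).+1%:R; pose b : K := j.+1%:R; pose w := gweight j.
have [a0 b0] : a != 0 /\ b != 0 by rewrite !pnatr_eq0.
have w0 : w != 0 by rewrite lt0r_neq0 ?gweight_gt0.
have eS : gweight j.+1 = a / b * w.
  by rewrite mulrAC -gweightS mulrAC divff ?mul1r// pnatr_eq0.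
have [ge0E ge0O] := (ge0 0, ge0 1); have [ge1E ge1O] := (ge1 0, ge1 1).
rewrite /= ?addn0 ?addn1 in ge0E ge0O ge1E ge1O.
split=> [i ij|m].
  rewrite rec [j.+1.-1]/=; have [ij'|ij'] := ltnP i j.
    by rewrite lt0// lt1 ?mulr0 ?subr0 ?mulr0//; lia.
  have [->|->] : i = j \/ i = j.+1 by lia.
    rewrite ge0E ge1E /ratio !addn0 /gnorm [gweight_pred _]/= -/w eS.
    rewrite [j.+1`!]factS natrM -/b doubleS radSS.
    have -> : (n + j.*2)%:R = a + b by rewrite -natrD; congr (_%:R); lia.
    have ab0 : a + b != 0 by rewrite -natrD pnatr_eq0.
    have := rad_neq0 j.*2; have := dfact_neq0 0.
    move: (rad _) (dfact 0)%:R j`!%:R => x y z y0 x0.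
    clearbody a b w; field.
    by rewrite a0 b0 w0 ab0 x0 y0.
  by rewrite ge0O ge1O !mulr0 subr0 mulr0.
rewrite rec [j.+1.-1]/=.
have := ge0 m.+2; have := ge1 m.+2.
rewrite !addnS !addSn => -> ->; rewrite /= negbK; case: ifP => [|om].
  by rewrite !mulr0 subr0 mulr0.
rewrite /gnorm [gweight_pred _]/= -/w eS /ratio.
pose h : K := m.+2%:R; have h0 : h != 0 by rewrite pnatr_eq0.
have -> : (j.+1 + m.+2)%N = (j + m).+3 by lia.
have -> : (j + m.+2)%N = (j + m).+2 by lia.
have -> : (j.+2 + m)%N = (j + m).+2 by lia.
have -> : (j.+1.*2 + m.+2)%N = (j.*2 + m.+2).+2 by lia.
have -> : (j.+2.*2 + m)%N = (j.*2 + m.+2).+2 by lia.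
rewrite dfactSS [(j + m).+3`!]factS radSS; move: ((j + m).+2)`! => z.
rewrite !natrM -/h.
have -> : (j + m).+3%:R = b + h by rewrite -natrD; congr (_%:R); lia.
have -> : (n + (j.*2 + m.+2))%:R = a + b + h by rewrite -!natrD; congr (_%:R); lia.
have abh0 : a + b + h != 0 by rewrite -!natrD pnatr_eq0.
have := rad_neq0 (j.*2 + m.+2); have := dfact_neq0 m.
move: (rad _) (dfact m)%:R => x y y0 x0.
clearbody a b w h; field.
by rewrite a0 b0 w0 h0 abh0 x0 y0.
Qed.

(** The starting point of orthogonality. It rests on the explicit moments above because the
    recurrence trades a higher index for a higher power of ['X]: vanishing at the boundary power
    needs the exact values one and two indices below. *)
Lemma zonal_mean_gegenbauer j : mu (gegenbauer j) = (j == 0%N)%:R.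
Proof.
case: j => [|j].
  rewrite -[gegenbauer 0]/1 -(expr0 'X) zonal_meanXn /zonal_moment.
  by rewrite /= divr1.
have [lt0 _] := zonal_mean_gegenbauerM j.+1.
by have := lt0 0 (ltn0Sn j); rewrite mul1r.
Qed.

(** Multiplication by ['X] is symmetric for [mu], so the recurrence may act on either factor; this
    lowers [i]. *)
Lemma gegenbauer_orthogonal i j :
  mu (gegenbauer i * gegenbauer j) = (i == j)%:R / gnorm i.
Proof.
have gn0 k : gnorm k != 0 by rewrite lt0r_neq0 ?gnorm_gt0.
have gw0 k : gweight k != 0 by rewrite lt0r_neq0 ?gweight_gt0.
elim/ltn_ind: i j => -[|i] IHi j.
  rewrite -[gegenbauer 0]/1 mul1r zonal_mean_gegenbauer eq_sym.
  by rewrite /gnorm /gweight /= addr0 add0n binn divr1.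
have muZ (c : K) p q : mu ((c *: p) * q) = c * mu (p * q).
  by rewrite -[(c *: p) * q]scalerAl linearZ.
have recM k l : gnorm k * mu ('X * gegenbauer k * gegenbauer l) =
    gweight k * mu (gegenbauer k.+1 * gegenbauer l) +
    gweight_pred k * mu (gegenbauer k.-1 * gegenbauer l).
  by rewrite -!muZ -linearD -mulrDl -gegenbauer_rec.
have recI l : mu (gegenbauer i * gegenbauer l) = (i == l)%:R / gnorm i by apply: IHi.
have recP l : gweight_pred i * mu (gegenbauer i.-1 * gegenbauer l) =
    gweight_pred i * ((i == l.+1)%:R / gnorm l).
  case: i IHi recI => [|i] IHi recI; first by rewrite !mul0r.
  by rewrite IHi// eqSS; case: eqVneq => [->|]; rewrite ?mul0r.
have gwP : gweight j * (i == j.+1)%:R = gweight_pred i * (i == j.+1)%:R.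
  by have [->|_] := eqVneq i j.+1; rewrite ?mulr0.
apply: (mulfI (gw0 i)).
have eqA : mu ('X * gegenbauer i * gegenbauer j) = (gnorm j)^-1 *
    (gweight j * ((i == j.+1)%:R / gnorm i) + gweight_pred j * ((i == j.-1)%:R / gnorm i)).
  rewrite mulrAC; apply: (canRL (mulKf (gn0 j))); rewrite recM.
  by rewrite !(mulrC _ (gegenbauer i)) !recI.
have /esym/(canRL (addrK _)) := recM i j; rewrite recP eqA => ->.
have -> : (gnorm j)^-1 * (gweight j * ((i == j.+1)%:R / gnorm i) +
    gweight_pred j * ((i == j.-1)%:R / gnorm i)) =
    (gnorm j)^-1 * (gweight_pred i * (i == j.+1)%:R +
    gweight_pred j * (i == j.-1)%:R) / gnorm i.
  by rewrite -gwP; ring.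
rewrite [gnorm i * _]mulrC divfK//.
case: j {recP eqA gwP} => [|j]; first by rewrite /= !mul0r !mulr0; ring.
rewrite eqSS [j.+1.-1]/= [gweight_pred j.+1]/=.
have [->|_] := eqVneq i j; last by rewrite !mul0r !mulr0; ring.
by rewrite /= (_ : (j == j.+2) = false); [ring|lia].
Qed.

(* Summing Christoffel-Darboux kernels smooths the cut-off: the square of a
   single kernel would only give the rate [O(1 / r)]. *)
Definition cd_kernel j : {poly K} := \sum_(i < j.+1) gnorm i *: gegenbauer i.
Definition cd_sum r : {poly K} := \sum_(j < r) cd_kernel j.

(** The Christoffel-Darboux formula at the point 1; the sum telescopes. *)
Lemma cd_kernelM j : (1 - 'X) * cd_kernel j =
  gweight j *: (gegenbauer j - gegenbauer j.+1).
Proof.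
have gegM k : (1 - 'X) * (gnorm k *: gegenbauer k) = gweight k *: (gegenbauer k -
    gegenbauer k.+1) - gweight_pred k *: (gegenbauer k.-1 - gegenbauer k).
  have -> : (1 - 'X) * (gnorm k *: gegenbauer k) =
      gnorm k *: gegenbauer k - gnorm k *: ('X * gegenbauer k).
    by rewrite mulrBl mul1r -[_ * (_ *: _)]scalerAr.
  by rewrite gegenbauer_rec /gnorm scalerDl !scalerBr; ring.
elim: j => [|j IHj].
  by rewrite /cd_kernel big_ord1 gegM [gweight_pred _]/= scale0r subr0.
rewrite /cd_kernel big_ord_recr -/(cd_kernel j) /= mulrDr IHj gegM.
by rewrite [gweight_pred _]/= [j.+1.-1]/= addrC subrK.
Qed.

Lemma zonal_mean_cd_kernel j i : mu (cd_kernel j * gegenbauer i) = (i <= j)%:R.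
Proof.
have muZ (c : K) p q : mu ((c *: p) * q) = c * mu (p * q).
  by rewrite -[(c *: p) * q]scalerAl linearZ.
rewrite /cd_kernel mulr_suml (linear_sum mu) /=.
have [ij|ji] := leqP i j.
  rewrite (bigD1 (Ordinal (ij : i < j.+1)%N))//= big1 => [|k /negPf ki].
    rewrite muZ gegenbauer_orthogonal eqxx mul1r addr0.
    by rewrite divff// lt0r_neq0 ?gnorm_gt0.
  rewrite muZ gegenbauer_orthogonal.
  by rewrite (_ : (k == i :> nat) = false) ?mul0r ?mulr0//; exact: ki.
rewrite big1// => k _; rewrite muZ gegenbauer_orthogonal.
by rewrite ltn_eqF ?mul0r ?mulr0//; have := ltn_ord k; lia.
Qed.

Lemma zonal_mean_cd_sum r i : (i <= r)%N ->
  mu (cd_sum r * gegenbauer i) = (r - i)%:R.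
Proof.
move=> ir; rewrite /cd_sum mulr_suml (linear_sum mu) /=.
under eq_bigr do rewrite zonal_mean_cd_kernel.
rewrite -natr_sum -(big_mkord xpredT (fun j => (i <= j : nat)%N)).
rewrite (big_cat_nat (leq0n i) ir) /= big_nat big1 => [|j /andP[_ ji]]; last by rewrite leqNgt ji.
rewrite add0n; congr (_%:R); rewrite -[RHS]muln1 -sum_nat_const_nat.
by apply: eq_big_nat => j /andP[-> _].
Qed.

Lemma sum_bin_diag m : (\sum_(i < m) 'C(i + d, d) = 'C(m + d, d.+1))%N.
Proof.
elim: m => [|m IHm]; first by rewrite big_ord0 bin_small.
by rewrite big_ord_recr /= IHm addSn binS addnC.
Qed.

(** Christoffel-Darboux turns one factor into differences of consecutive Gegenbauer polynomials;
    against the other, whose coefficients fall off linearly, each difference yields 1. The result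
    has order [r^(d + 1)]. *)
Lemma zonal_mean_cd_sum_height r :
  mu (cd_sum r ^+ 2 * (1 - 'X)) = 'C(r + d, d.+1)%:R.
Proof.
rewrite expr2 -mulrA [X in mu (_ * X)]mulrC {2}/cd_sum mulr_sumr mulr_sumr.
rewrite (linear_sum mu) /= -sum_bin_diag natr_sum; apply: eq_bigr => j _.
rewrite cd_kernelM -[_ * (_ *: _)]scalerAr linearZ /= mulrBr linearB /=.
rewrite !zonal_mean_cd_sum//; last exact: ltnW.
rewrite -natrB; last by lia.
by rewrite (_ : (r - j - (r - j.+1) = 1)%N) ?mulr1//; have := ltn_ord j; lia.
Qed.

Lemma sum_bin_diag2 m :
  (\sum_(i < m) 'C(i + d, d) * (m - i) = 'C(m + d.+1, d.+2))%N.
Proof.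
elim: m => [|m IHm]; first by rewrite big_ord0 bin_small.
have -> : (\sum_(i < m.+1) 'C(i + d, d) * (m.+1 - i) =
    \sum_(i < m.+1) 'C(i + d, d) * (m - i) + \sum_(i < m.+1) 'C(i + d, d))%N.
  rewrite -big_split /=; apply: eq_bigr => i _.
  by rewrite -mulnSr subSn// -ltnS.
rewrite big_ord_recr /= subnn muln0 addn0 IHm sum_bin_diag.
by rewrite !addnS !addSn [RHS]binS addnC.
Qed.

Lemma sum_bin_diag3 r : (\sum_(j < r) 'C(j + d.+2, d.+2) = 'C(r + d.+2, d.+3))%N.
Proof.
elim: r => [|r IHr]; first by rewrite big_ord0 bin_small.
by rewrite big_ord_recr /= IHr addSn binS addnC.
Qed.

(** Lowering [gnorm i] to [gweight i] and [r - i] to [j + 1 - i] makes the double sum a binomial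
    coefficient, two orders in [r] above the height. *)
Lemma zonal_mean_cd_sum_norm r : 'C(r + d.+2, d.+3)%:R <= mu (cd_sum r ^+ 2).
Proof.
rewrite expr2 {2}/cd_sum mulr_sumr (linear_sum mu) /= -sum_bin_diag3 natr_sum.
apply: ler_sum => j _; rewrite /cd_kernel mulr_sumr (linear_sum mu) /=.
have -> : (j + d.+2 = j.+1 + d.+1)%N by lia.
rewrite -sum_bin_diag2 natr_sum; apply: ler_sum => i _.
have [ir jr] : (i <= r)%N /\ (j < r)%N by have := ltn_ord i; have := ltn_ord j; lia.
rewrite -[_ * (_ *: _)]scalerAr linearZ /= zonal_mean_cd_sum// natrM.
apply: ler_pM => //; first by rewrite lerDl gweight_pred_ge0.
by rewrite ler_nat; lia.
Qed.

Lemma size_cd_sum r : (size (cd_sum r) <= r)%N.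
Proof.
apply: (leq_trans (size_sum _ _ _)); apply/bigmax_leqP => j _.
apply: (leq_trans (size_sum _ _ _)); apply/bigmax_leqP => i _.
apply: (leq_trans (size_scale_leq _ _)); apply: (leq_trans (size_gegenbauer _)).
by have := ltn_ord i; have := ltn_ord j; lia.
Qed.

(** The quotient of the two binomials is [(d + 2) (d + 3) / ((r + d + 2) (r + d + 1))]. *)
Lemma narrow_kernel r : (0 < r)%N -> exists q : {poly K},
  [/\ (size q <= r)%N, mu (q ^+ 2) = 1 &
      mu (q ^+ 2 * (1 - 'X)) <= (d.+2 * d.+3)%:R / r%:R ^+ 2].
Proof.
move=> r0; pose N := mu (cd_sum r ^+ 2).
have C0 : (0 < 'C(r + d.+2, d.+3))%N by rewrite bin_gt0; lia.
have N0 : 0 < N by apply: lt_le_trans (zonal_mean_cd_sum_norm r); rewrite ltr0n.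
have qZ : ((Num.sqrt N)^-1 *: cd_sum r) ^+ 2 = N^-1 *: cd_sum r ^+ 2.
  by rewrite exprZn exprVn sqr_sqrtr// ltW.
exists ((Num.sqrt N)^-1 *: cd_sum r); split.
- by rewrite (leq_trans (size_scale_leq _ _))// size_cd_sum.
- by rewrite qZ linearZ /= mulVf// lt0r_neq0.
rewrite qZ -[_ *: _ * _]scalerAl linearZ /= zonal_mean_cd_sum_height mulrC.
rewrite ler_pdivrMr// mulrAC ler_pdivlMr ?exprn_gt0 ?ltr0n//.
apply: le_trans (ler_wpM2l _ (zonal_mean_cd_sum_norm r)); last exact: ler0n.
rewrite -natrX -!natrM ler_nat.
have -> : (d.+2 * d.+3 * 'C(r + d.+2, d.+3) = (r + d).+2 * (r + d).+1 * 'C(r + d, d.+1))%N.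
  rewrite !addnS -mulnA -(mul_bin_diag (r + d).+2) mulnCA [(r + d).+2.-1]/=.
  by rewrite -(mul_bin_diag (r + d).+1) mulnA.
by rewrite mulnC leq_mul2r; apply/orP; right; nia.
Qed.

End Gegenbauer.

(** * The kernel operator *)

Section KernelSOS.
Context {K : realType} {n : nat}.
Implicit Types (p q f : {mpoly K[n]}) (v : 'I_n -> K) (h : {poly K}).
Hypothesis n_gt0 : (0 < n)%N.
Variable rho : K.
Hypothesis rho_gt0 : 0 < rho.

Local Notation L := (sphere_mean rho).
Local Notation mu := (@zonal_mean K n).

(** Polynomials in two sets of variables, kept as finite tensors because [psd_form_sos] consumes
    them so; [d] bounds the degree in [v]. *)
Definition separable d (F : ('I_n -> K) -> {mpoly K[n]}) : Prop :=
  exists2 s : seq ({mpoly K[n]} * {mpoly K[n]}),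
    all (fun t => msize t.1 <= d.+1)%N s &
    forall v, F v = \sum_(t <- s) t.1.@[v] *: t.2.

Lemma separableD d F G : separable d F -> separable d G ->
  separable d (fun v => F v + G v).
Proof.
move=> [s sd sF] [t td tG]; exists (s ++ t) => [|v]; first by rewrite all_cat sd.
by rewrite big_cat sF tG.
Qed.

Lemma separableM d e F G : separable d F -> separable e G ->
  separable (d + e) (fun v => F v * G v).
Proof.
move=> [s sd sF] [t te tG].
exists [seq (a.1 * b.1, a.2 * b.2) | a <- s, b <- t].
  apply/allP => _ /allpairsP[[a b] [/= /(allP sd) ad /(allP te) be ->]].
  exact: msizeM_leq.
move=> v; rewrite sF tG big_allpairs_dep /= mulr_suml; apply: eq_bigr => a _.
rewrite mulr_sumr; apply: eq_bigr => b _; rewrite mevalM.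
by rewrite -!mul_mpolyC mpolyCM; ring.
Qed.

Lemma separable_cst p : separable 0 (fun=> p).
Proof.
exists [:: (1, p)] => [|v]; first by rewrite /= msize1.
by rewrite big_seq1 meval1 scale1r.
Qed.

Lemma separable_zonal_form : separable 1 (zonal_form rho).
Proof.
exists [seq (rho ^- 2 *: 'X_i, 'X_i) | i <- index_enum 'I_n].
  apply/allP => _ /mapP[i _ ->] /=; rewrite (leq_trans (msizeZ_le _ _))//.
  by rewrite msizeX mdeg1.
move=> v; rewrite big_map /zonal_form; apply: eq_bigr => i _.
by rewrite mevalZ mevalXU mulrC.
Qed.

Lemma separable_zonal d h : (size h <= d.+1)%N -> separable d (fun v => zonal rho v h).
Proof.
move=> hd; have powS e : separable e (fun v => zonal_form rho v ^+ e).
  elim: e => [|e [s sd sF]].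
    by have [s sd sF] := separable_cst 1; exists s => // v; rewrite expr0.
  have [t td tF] := separableM (separable_zonal_form) (ex_intro2 _ _ s sd sF).
  by exists t => // v; rewrite exprS tF.
suff: separable d (fun v => \sum_(e < size h) h`_e *: zonal_form rho v ^+ e).
  by move=> [s sd sF]; exists s => // v; rewrite zonal_coef sF.
have : all (fun e => e <= d)%N [seq val e | e <- index_enum 'I_(size h)].
  apply/allP => _ /mapP[e _ ->]; exact: leq_trans (ltn_ord e) hd.
elim: (index_enum _) => [|e r IHr] /=.
  move=> _; have [s sd sF] := separable_cst 0.
  exists s => [|v]; last by rewrite -sF big_nil.
  by apply: sub_all sd => t /leq_trans; apply.
move=> /andP[ed /IHr rS].
have [s sd sF] : separable d (fun v => h`_e *: zonal_form rho v ^+ e).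
  have [s sd sF] := separableM (separable_cst (h`_e)%:MP) (powS e).
  exists s => [|v]; last by rewrite -sF mul_mpolyC.
  by apply: sub_all sd => t /leq_trans; apply.
have [t td tF] := separableD (ex_intro2 _ _ s sd sF) rS.
by exists t => // v; rewrite big_cons tF.
Qed.

Lemma zonal_sqr_sos d h f : (size h <= d.+1)%N ->
  (forall v, on_sphere rho v -> 0 <= f.@[v]) ->
  exists2 P : {mpoly K[n]}, sphere_sos rho d P &
    forall v, P.@[v] = L (zonal rho v (h ^+ 2) * f).
Proof.
move=> hd f0; have [s sd sE] := separable_zonal hd.
pose B u w := L (u * w * f).
have [|||r rd rE] := @psd_form_sos K n {mpoly K[n]} B _ _ _ d.+1 s sd.
- move=> u a w w'; rewrite /B.
  have -> : u * (a *: w + w') * f = a *: (u * w * f) + u * w' * f.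
    by rewrite -!mul_mpolyC; ring.
  by rewrite linearD linearZ.
- by move=> u w; rewrite /B [u * w]mulrC.
- move=> w; apply: (sphere_mean_ge0 n_gt0 rho_gt0) => v vS.
  by rewrite !mevalM; apply: mulr_ge0; [rewrite -expr2 sqr_ge0|exact: f0].
exists (\sum_(q <- r) q ^+ 2).
  exists r => // v _; rewrite (raddf_sum (meval v)) /=.
  by apply: eq_bigr => q _; rewrite rmorphXn.
move=> v; rewrite -rE /zonal rmorphXn /= -/(zonal rho v h) sE expr2.
rewrite !mulr_suml (linear_sum L) (raddf_sum (meval v)) /=; apply: eq_bigr => t _.
rewrite mulr_sumr mulr_suml (linear_sum L) (raddf_sum (meval v)) /=.
apply: eq_bigr => t' _; rewrite mevalZ mevalM /B.
have -> : t.1.@[v] *: t.2 * (t'.1.@[v] *: t'.2) * f =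
    (t.1.@[v] * t'.1.@[v]) *: (t.2 * t'.2 * f).
  by rewrite -!mul_mpolyC mpolyCM; ring.
by rewrite linearZ /= mulrC.
Qed.

Lemma on_sphere_pole (i0 : 'I_n) : on_sphere rho (fun j => if j == i0 then rho else 0).
Proof.
rewrite /on_sphere (bigD1 i0)//= eqxx big1 ?addr0// => j /negPf ->.
by rewrite expr0n.
Qed.

Lemma zonal_form_bound v w : on_sphere rho v -> on_sphere rho w ->
  `|(zonal_form rho v).@[w]| <= 1.
Proof.
move=> vS wS; have r2 : 0 < rho ^+ 2 by rewrite exprn_gt0.
have -> : (zonal_form rho v).@[w] = (\sum_(i < n) v i * w i) / rho ^+ 2.
  rewrite (raddf_sum (meval w)) /= mulr_suml; apply: eq_bigr => i _.
  by rewrite mevalZ mevalXU mulrAC.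
have sqr_pm (e : K) : e ^+ 2 = 1 ->
    0 <= 2 * rho ^+ 2 + 2 * (e * \sum_(i < n) v i * w i).
  move=> e2; have : 0 <= \sum_(i < n) (v i + e * w i) ^+ 2.
    by apply: sumr_ge0 => i _; exact: sqr_ge0.
  suff -> : \sum_(i < n) (v i + e * w i) ^+ 2 =
    rho ^+ 2 + rho ^+ 2 + 2 * (e * \sum_(i < n) v i * w i) by lra.
  rewrite -{1}vS -wS !mulr_sumr -!big_split /=; apply: eq_bigr => i _.
  by rewrite sqrrD exprMn e2; ring.
rewrite normrM normfV (gtr0_norm r2) ler_pdivrMr// mul1r ler_norml.
have := sqr_pm 1 (expr1n _ 2); have := sqr_pm (-1) (sqrr_sign _ 1).
by rewrite mul1r mulN1r; lra.
Qed.

Lemma zonal_mean_ge0 h :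
  (forall t, -1 <= t <= 1 -> 0 <= h.[t]) -> 0 <= mu h.
Proof.
move=> h0; rewrite -(sphere_mean_zonal n_gt0 rho_gt0 h (on_sphere_pole (Ordinal n_gt0))).
apply: (sphere_mean_ge0 n_gt0 rho_gt0) => w wS; set v := fun _ => _.
have -> : (zonal rho v h).@[w] = h.[(zonal_form rho v).@[w]].
  rewrite zonal_coef (raddf_sum (meval w)) /= horner_coef; apply: eq_bigr => e _.
  by rewrite mevalZ rmorphXn.
by apply: h0; rewrite -ler_norml; apply: zonal_form_bound => //; exact: on_sphere_pole.
Qed.

(** [C] is the sum of the absolute values of the coefficients of [(a - a(1)) / ('X - 1)]. It bounds
    that quotient on [[-1, 1]] and is independent of [h]. *)
Lemma zonal_mean_deviation (a : {poly K}) : exists2 C : K, 0 <= C &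
  forall h, `|mu (h ^+ 2 * (a - (a.[1])%:P))| <= C * mu (h ^+ 2 * (1 - 'X)).
Proof.
have /factor_theorem[c cE] : root (a - (a.[1])%:P) 1.
  by rewrite /root !hornerE subrr.
exists (\sum_(i < size c) `|c`_i|); first by apply: sumr_ge0.
move=> h; set C := \sum_(i < _) _.
have cC t : -1 <= t <= 1 -> `|c.[t]| <= C.
  rewrite -ler_norml => t1; rewrite horner_coef; apply: le_trans (ler_norm_sum _ _ _) _.
  apply: ler_sum => i _; rewrite normrM ler_piMr// normrX exprn_ile1//.
have muC (e : K) : `|e| = 1 -> 0 <= mu (h ^+ 2 * (1 - 'X) * (C%:P + e *: c)).
  move=> e1; apply: zonal_mean_ge0 => t t1.
  have height0 : 0 <= (1 - 'X).[t] by rewrite !hornerE; lra.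
  have : 0 <= (C%:P + e *: c).[t].
    rewrite hornerD hornerC hornerZ -lerBlDr sub0r; have := cC t t1.
    have -> : `|c.[t]| = `|e * c.[t]| by rewrite normrM e1 mul1r.
    by rewrite ler_norml; lra.
  by rewrite 2!hornerM horner_exp => ge0; rewrite mulr_ge0// mulr_ge0 ?sqr_ge0.
have muE (e : K) : mu (h ^+ 2 * (1 - 'X) * (C%:P + e *: c)) =
    C * mu (h ^+ 2 * (1 - 'X)) - e * mu (h ^+ 2 * (a - (a.[1])%:P)).
  have -> : h ^+ 2 * (1 - 'X) * (C%:P + e *: c) =
      C *: (h ^+ 2 * (1 - 'X)) - e *: (h ^+ 2 * (a - (a.[1])%:P)).
    by rewrite cE -!mul_polyC; ring.
  by rewrite linearB !linearZ.
rewrite ler_norml; have := muC 1 (normr1 _); have := muC (-1) (normrN1 _).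
by rewrite !muE mul1r mulN1r; lra.
Qed.

End KernelSOS.

(** * The rate for certificates *)

Section Rate.
Context {K : realType} {n : nat}.
Implicit Types (p q f : {mpoly K[n]}) (v : 'I_n -> K) (h : {poly K}).
Hypothesis n_gt0 : (0 < n)%N.
Variable rho : K.
Hypothesis rho_gt0 : 0 < rho.

Local Notation L := (sphere_mean rho).
Local Notation mu := (@zonal_mean K n).

(** [C] and [d] are fixed before [h]: this uniformity lets the kernel vary with [r] at a constant
    cost in degree. *)
Lemma zonal_error_sos (s : seq ({poly K} * {mpoly K[n]})) :
  exists C d, 0 <= C /\ forall h, sphere_sos rho d
    ((C * mu (h ^+ 2 * (1 - 'X)))%:MP -
     \sum_(t <- s) mu (h ^+ 2 * (t.1 - (t.1.[1])%:P)) *: t.2).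
Proof.
elim: s => [|[a b] s [C [d [C0 IHs]]]].
  exists 0, 0; split=> // h; rewrite big_nil subr0 mul0r; exact: sphere_sosC.
have [A A0 aA] := zonal_mean_deviation n_gt0 rho_gt0 a.
have [c [e [c0 bc]]] := sphere_archimedean rho b.
exists (A * c + C), (maxn d e); split=> [|h]; first by rewrite addr_ge0 ?mulr_ge0.
rewrite big_cons /=; set x := mu (h ^+ 2 * (a - _)).
set y := mu (h ^+ 2 * (1 - 'X)).
have -> : ((A * c + C) * y)%:MP - (x *: b +
      \sum_(t <- s) mu (h ^+ 2 * (t.1 - (t.1.[1])%:P)) *: t.2) =
    ((C * y)%:MP - \sum_(t <- s) mu (h ^+ 2 * (t.1 - (t.1.[1])%:P)) *: t.2) +
    (`|x| *: (c%:MP - (-1) ^+ (x < 0)%R *: b) + ((A * y - `|x|) * c)%:MP).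
  have {1}-> : x = `|x| * (-1) ^+ (x < 0)%R.
    by rewrite {1}[x]realEsign ?num_real// mulrC.
  rewrite -!mul_mpolyC !(mpolyCM, mpolyCD, mpolyCB); ring.
apply: sphere_sosD; first by apply: sphere_sosW (IHs h); rewrite leq_maxl.
apply: sphere_sosD.
  by apply: sphere_sosZ => //; apply: sphere_sosW (bc _); rewrite leq_maxr.
by apply: sphere_sosC; rewrite mulr_ge0// subr_ge0 aA.
Qed.

Lemma sphere_sos_rate_gt1 f : (1 < n)%N ->
  (forall v, on_sphere rho v -> 0 <= f.@[v]) ->
  exists C d, 0 <= C /\ forall r, (0 < r)%N -> (d <= r)%N ->
    sphere_sos rho r (f + (C / r%:R ^+ 2)%:MP).
Proof.
move=> n_gt1 f0.
have [s sE] := sphere_mean_zonalM n_gt0 rho_gt0 n_gt1 f.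
have [C [d [C0 CE]]] := zonal_error_sos s.
exists (C * (n * n.+1)%:R), d; split=> [|r r0 dr]; first by rewrite mulr_ge0.
have [q [qr q1 qh]] : exists q : {poly K}, [/\ (size q <= r)%N, mu (q ^+ 2) = 1 &
    mu (q ^+ 2 * (1 - 'X)) <= (n * n.+1)%:R / r%:R ^+ 2].
  by case: (n) n_gt1 => [|[|e]] // _; exact: narrow_kernel.
have [P Psos PE] := zonal_sqr_sos n_gt0 rho_gt0 (leqW qr) f0.
set y := mu (q ^+ 2 * (1 - 'X)) in qh.
pose E := \sum_(t <- s) mu (q ^+ 2 * (t.1 - (t.1.[1])%:P)) *: t.2.
(* [P] is [T f], which equals [f + E] on the sphere since [mu (q ^+ 2) = 1]. The middle term
   compensates [E], the last is the slack in the bound on [y]. *)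
apply: (@sphere_sos_eq _ _ _ r (P + ((C * y)%:MP - E) +
    (C * ((n * n.+1)%:R / r%:R ^+ 2 - y))%:MP)).
  move=> v vS; have [sL sf] := sE v vS.
  have PfE : P.@[v] = f.@[v] + E.@[v].
    rewrite PE sL sf (raddf_sum (meval v)) /= -big_split /=; apply: eq_bigr => t _.
    rewrite mevalZ -mulrDl; congr (_ * _).
    have -> : q ^+ 2 * (t.1 - (t.1.[1])%:P) = q ^+ 2 * t.1 - t.1.[1] *: q ^+ 2.
      by rewrite mulrBr [_ * _%:P]mulrC mul_polyC.
    by rewrite linearB linearZ /= q1 mulr1 addrC subrK.
  by rewrite !(mevalD, mevalB, mevalC) PfE; ring.
apply: sphere_sosD; first apply: sphere_sosD => //.
  exact: sphere_sosW dr (CE q).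
by apply: sphere_sosC; rewrite mulr_ge0// subr_ge0.
Qed.

(* On the two points [rho], [- rho], a nonnegative function is a combination of
   [(x + rho)^2] and [(x - rho)^2]. *)
Lemma sphere_sos_dim1 f : n = 1%N ->
  (forall v, on_sphere rho v -> 0 <= f.@[v]) -> sphere_sos rho 1 f.
Proof.
move=> n1 f0; pose i0 := Ordinal n_gt0.
have eqi0 i : i = i0 by apply/val_inj => /=; have := ltn_ord i; lia.
have sum1 (F : 'I_n -> K) : \sum_i F i = F i0.
  by rewrite (bigD1 i0)//= big1 ?addr0// => i; rewrite (eqi0 i) eqxx.
pose w (e : bool) (i : 'I_n) : K := (-1) ^+ e * rho.
have wS e : on_sphere rho (w e) by rewrite /on_sphere sum1 exprMn sqrr_sign mul1r.
have rho0 : rho != 0 := lt0r_neq0 rho_gt0.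
pose g e := (f.@[w e] / (4 * rho ^+ 2)) *: ('X_i0 + ((-1) ^+ e * rho)%:MP) ^+ 2.
apply: (@sphere_sos_eq _ _ _ 1 (g false + g true)).
  move=> v; rewrite /on_sphere sum1 => /eqP; rewrite eqf_sqr => vE.
  have [e eE] : exists e : bool, v i0 = (-1) ^+ e * rho.
    case/orP: vE => /eqP ->; first by exists false; rewrite expr0 mul1r.
    by exists true; rewrite expr1 mulN1r.
  have -> : f.@[v] = f.@[w e] by apply: meval_eq => i; rewrite (eqi0 i) eE.
  rewrite mevalD !mevalZ !rmorphXn /= !mevalD !mevalXU !mevalC eE.
  by case: e {eE}; rewrite expr0 expr1; field.
apply: sphere_sosD; apply: sphere_sosZ.
- by rewrite divr_ge0 ?f0// mulr_ge0 ?sqr_ge0.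
- by apply/sphere_sos_sqr/msizeD_leq; rewrite ?msizeX ?mdeg1// msizeC; case: (_ != 0).
- by rewrite divr_ge0 ?f0// mulr_ge0 ?sqr_ge0.
- by apply/sphere_sos_sqr/msizeD_leq; rewrite ?msizeX ?mdeg1// msizeC; case: (_ != 0).
Qed.

Lemma sphere_sos_rate f : (forall v, on_sphere rho v -> 0 <= f.@[v]) ->
  exists C d, 0 <= C /\ forall r, (0 < r)%N -> (d <= r)%N ->
    sphere_sos rho r (f + (C / r%:R ^+ 2)%:MP).
Proof.
move=> f0; have [n1|n1] := leqP n 1; last exact: sphere_sos_rate_gt1.
exists 0, 1; split=> // r r0 _; rewrite mul0r mpolyC0 addr0.
by apply: (sphere_sosW r0); apply: sphere_sos_dim1 => //; move: n_gt0; lia.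
Qed.

End Rate.

(** * Weak duality *)

Section Duality.
Context {K : realType} {n : nat}.
Implicit Types (p q f : {mpoly K[n]}) (v : 'I_n -> K).
Variable rho : K.

Local Notation g := (@sphere_poly K n rho).

Lemma sphere_sos_certificate r p : 0 < rho -> (0 < r)%N -> (msize p <= (2 * r).+1)%N ->
  sphere_sos rho r p -> exists (s : seq {mpoly K[n]}) (t : {mpoly K[n]}),
    [/\ all (fun q => msize q <= r.+1)%N s, (msize t <= (2 * r).-1)%N &
        p = \sum_(q <- s) q ^+ 2 + t * g].
Proof.
move=> rho_gt0 r0 pr [s sr sE].
have sosr : (msize (\sum_(q <- s) q ^+ 2) <= (2 * r).+1)%N.
  rewrite big_seq; apply: (big_ind (fun q => msize q <= (2 * r).+1)%N).
  - by rewrite msize0.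
  - by move=> a b; exact: msizeD_leq.
  - by move=> q /(allP sr) qr; rewrite expr2 mul2n -addnn; exact: msizeM_leq.
(* With [D = 2 r - 1], degree [D + 1 = 2 r] for the difference gives the cofactor exactly the degree
   allowed in the truncated module. *)
have [|||t tr tE] := @sphere_vanishing _ _ _ rho_gt0 (2 * r).-1
  (p - \sum_(q <- s) q ^+ 2).
- by lia.
- by rewrite prednK ?muln_gt0//; apply: msizeD_leq => //; rewrite msizeN.
- move=> v vS; rewrite mevalB sE// (raddf_sum (meval v)) /=.
  by under eq_bigr do rewrite -rmorphXn /=; rewrite subrr.
by exists s, t; rewrite -tE addrC subrK.
Qed.

Lemma certificate_qmodule r p (s : seq {mpoly K[n]}) (t : {mpoly K[n]}) :
  all (fun q => msize q <= r.+1)%N s -> (msize t <= (2 * r).-1)%N ->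
  p = \sum_(q <- s) q ^+ 2 + t * g -> qmodule rho r p.
Proof.
move=> sr tr ->; exists (\sum_(q <- s) q ^+ 2), t; split=> //; split; first by exists s.
rewrite big_seq; apply: (big_ind (fun q => msize q <= (2 * r).+1)%N).
- by rewrite msize0.
- by move=> a b; exact: msizeD_leq.
- by move=> q /(allP sr) qr; rewrite expr2 mul2n -addnn; exact: msizeM_leq.
Qed.

Lemma riesz_is_linear d (y : @momseq K n d) : linear_for *%R (@riesz K n d y).
Proof.
move=> c p q; rewrite /riesz mulr_sumr -big_split /=.
by apply: eq_bigr => a _; rewrite mcoeffD mcoeffZ mulrDl mulrA.
Qed.

HB.instance Definition _ d (y : @momseq K n d) :=
  GRing.isLinear.Build K {mpoly K[n]} K *%R (@riesz K n d y) (riesz_is_linear y).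

Lemma rieszC d (y : @momseq K n d) (c : K) : riesz y c%:MP = c * y bm0.
Proof.
rewrite /riesz (bigD1 bm0)//= mcoeffC eqxx mulr1 big1 ?addr0// => a /negPf a0.
by rewrite mcoeffC (_ : (a == 0 :> 'X_{1..n})%MM = false) ?mulr0 ?mul0r// -a0.
Qed.

Lemma sum_exponent (R : nmodType) t (F : 'X_{1..n < t.+1} -> R) :
  \sum_i F (exponent i) = \sum_a F a.
Proof. by rewrite /exponent -(big_enum_val F). Qed.

Lemma moment_mx_quadratic d t (y : @momseq K n d) (c : 'X_{1..n < t.+1} -> K) :
  let u := \col_i c (exponent i) in
  (u^T *m moment_mx t 1 y *m u) 0 0 =
  riesz y ((\sum_(a : 'X_{1..n < t.+1}) c a *: 'X_[a]) ^+ 2).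
Proof.
rewrite /= mxE; under [LHS]eq_bigr => j _ do rewrite !mxE big_distrl /=.
rewrite expr2 mulr_suml (linear_sum (@riesz K n _ y)) /= -sum_exponent exchange_big /=.
apply: eq_bigr => i _; rewrite mulr_sumr (linear_sum (@riesz K n _ y)) /= -sum_exponent.
apply: eq_bigr => j _; rewrite !mxE mul1r.
have -> : c (exponent i) *: 'X_[exponent i] * (c (exponent j) *: 'X_[exponent j]) =
    (c (exponent i) * c (exponent j)) *: 'X_[(exponent i + exponent j)%MM] :> {mpoly K[n]}.
  by rewrite mpolyXD -!mul_mpolyC mpolyCM; ring.
by rewrite linearZ /=; ring.
Qed.

(** Used with [a = b = r - 1]: each monomial multiple of the equation then corresponds to an entry
    of the localizing matrix. *)
Lemma mnm_split a b (m : 'X_{1..n}) : (mdeg m <= a + b)%N ->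
  exists m1 m2, [/\ m = (m1 + m2)%MM, (mdeg m1 <= a)%N & (mdeg m2 <= b)%N].
Proof.
elim: a m => [|a IHa] m mab; first by exists 0%MM, m; rewrite add0m mdeg0.
have [i mi|m0] := pickP (fun i => m i != 0%N); last first.
  exists 0%MM, m; rewrite add0m mdeg0 mdegE big1// => i _.
  by apply/eqP/negPn; rewrite m0.
have mE : m = (U_(i) + (m - U_(i)))%MM by rewrite addmC submK// lep1mP.
have [|m1 [m2 [mE' m1a m2b]]] := IHa (m - U_(i))%MM.
  by move: mab; rewrite {1}mE mdegD mdeg1.
exists (U_(i) + m1)%MM, m2; rewrite mdegD mdeg1; split=> //.
by rewrite {1}mE mE' addmA.
Qed.

Lemma riesz_sqr_ge0 r (y : @momseq K n (2 * r)) q : mlb_feasible rho r y ->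
  (msize q <= r.+1)%N -> 0 <= riesz y (q ^+ 2).
Proof.
move=> [_ [_ M0] _] qr; rewrite (mpolywE qr).
by rewrite -(moment_mx_quadratic y (fun a : 'X_{1..n < r.+1} => q@_a)).
Qed.

Lemma riesz_ideal_eq0 r (y : @momseq K n (2 * r)) t : (0 < r)%N -> mlb_feasible rho r y ->
  (msize t <= (2 * r).-1)%N -> riesz y (t * g) = 0.
Proof.
move=> r0 [_ _ Mg0] tr; rewrite [t]mpolyE mulr_suml (linear_sum (@riesz K n _ y)) /=.
rewrite big1_seq// => m /andP[_ /msize_mdeg_lt mt].
have [|m1 [m2 [mE m1r m2r]]] := @mnm_split r.-1 r.-1 m; first by move: mt; lia.
rewrite -!mul_mpolyC -mulrA mul_mpolyC linearZ /=.
rewrite -ltnS in m1r; rewrite -ltnS in m2r.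
have /matrixP/(_ (enum_rank (BMultinom m1r)) (enum_rank (BMultinom m2r))) := Mg0.
by rewrite !mxE /exponent !enum_rankK /= -mE mulrC => ->; rewrite mulr0.
Qed.

Lemma riesz_certificate_ge0 r (y : @momseq K n (2 * r)) p (s : seq {mpoly K[n]}) t :
  (0 < r)%N -> mlb_feasible rho r y ->
  all (fun q => msize q <= r.+1)%N s -> (msize t <= (2 * r).-1)%N ->
  p = \sum_(q <- s) q ^+ 2 + t * g -> 0 <= riesz y p.
Proof.
move=> r0 yf sr tr ->; rewrite linearD /= riesz_ideal_eq0// addr0.
rewrite (linear_sum (@riesz K n _ y)) /= big_seq; apply: sumr_ge0 => q /(allP sr).
exact: riesz_sqr_ge0.
Qed.

Definition dirac_moments d v : momseq d :=
  [ffun a : 'X_{1..n < d.+1} => \prod_(i < n) v i ^+ a i].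

Lemma riesz_dirac d v p : (msize p <= d.+1)%N -> riesz (dirac_moments d v) p = p.@[v].
Proof.
move=> pd; rewrite [in RHS](mpolywE pd) (raddf_sum (meval v)) /=.
by apply: eq_bigr => a _; rewrite ffunE mevalZ mevalX.
Qed.

Lemma msize_sphere_poly : (msize g <= 3)%N.
Proof.
apply: msizeD_leq; first by rewrite msizeC; case: (_ != 0).
rewrite msizeN; apply: (big_ind (fun q => msize q <= 3)%N).
- by rewrite msize0.
- by move=> a b; exact: msizeD_leq.
- by move=> i _; rewrite mpolyXn msizeX mdegMn mdeg1.
Qed.

Lemma dirac_feasible r v : (0 < r)%N -> on_sphere rho v ->
  mlb_feasible rho r (dirac_moments (2 * r) v).
Proof.
move=> r0 vS; split.
- by rewrite ffunE big1// => i _; rewrite mnm0E.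
- split.
    apply/is_hermitianmxP; rewrite expr0 scale1r; apply/matrixP => i j.
    by rewrite !mxE addmC.
  move=> u; pose c (a : 'X_{1..n < r.+1}) := u (enum_rank a) 0.
  have -> : u = \col_i c (exponent i).
    by apply/matrixP => i j; rewrite mxE ord1 /c /exponent enum_valK.
  rewrite moment_mx_quadratic riesz_dirac ?rmorphXn ?sqr_ge0//.
  rewrite expr2 mul2n -addnn; apply: msizeM_leq;
    apply: (big_ind (fun q => msize q <= r.+1)%N); rewrite ?msize0//;
    do ?[by move=> a b; exact: msizeD_leq];
    by move=> a _; rewrite (leq_trans (msizeZ_le _ _))// msizeX bmdeg.
- apply/matrixP => i j; rewrite !mxE riesz_dirac.
    by rewrite mevalM sphere_poly_eq0 ?mul0r.
  have -> : (2 * r).+1 = (2 + (r.-1 + r.-1)).+1 by lia.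
  apply: msizeM_leq; first exact: msize_sphere_poly.
  rewrite msizeX ltnS mdegD; have := bmdeg (exponent i); have := bmdeg (exponent j).
  by rewrite !ltnS; lia.
Qed.

End Duality.

(** * The rate of the hierarchies *)

Section Bounds.
Context {K : realType} {n : nat}.
Hypothesis n_gt0 : (0 < n)%N.
Variable rho : K.
Hypothesis rho_gt0 : 0 < rho.
Variables (f : {mpoly K[n]}) (fmin : K).
Hypothesis fminP : is_minimum (peval f @` sphere rho) fmin.

Lemma sphereP (x : 'rV[K]_n) : sphere rho x <-> on_sphere rho (x 0).
Proof.
have sum0 : 0 <= \sum_(i < n) x 0 i ^+ 2 by apply: sumr_ge0 => i _; exact: sqr_ge0.
rewrite /sphere /on_sphere /euclidean_norm /=; split=> [<-|->].
  by rewrite sqr_sqrtr.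
by rewrite sqrtr_sqr gtr0_norm.
Qed.

Lemma fmin_attained : exists2 v : 'I_n -> K, on_sphere rho v & f.@[v] = fmin.
Proof. by have [[x /sphereP xS fx] _] := fminP; exists (x 0). Qed.

Lemma fmin_le v : on_sphere rho v -> fmin <= f.@[v].
Proof.
move=> vS; have [_] := fminP; apply; exists (\row_i v i).
  apply/sphereP; rewrite /on_sphere -vS; apply: eq_bigr => i _.
  by rewrite mxE.
by apply: meval_eq => i; rewrite mxE.
Qed.

Lemma lb_le_fmin r : (lb rho f r <= fmin%:E)%E.
Proof.
apply: ge_ereal_sup => _ [a [sigma [t [[[s ->] _] _ fE]]] <-]; rewrite lee_fin.
have [v vS fv] := fmin_attained; move/(congr1 (meval v)): fE.
rewrite mevalB mevalC mevalD mevalM sphere_poly_eq0// mulr0 addr0 fv.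
rewrite (raddf_sum (meval v)) /= -subr_ge0 => ->; apply: sumr_ge0 => q _.
by rewrite rmorphXn sqr_ge0.
Qed.

Lemma mlb_le_fmin r : (0 < r)%N -> (msize f <= (2 * r).+1)%N ->
  (mlb rho f r <= fmin%:E)%E.
Proof.
move=> r0 fr; have [v vS fv] := fmin_attained.
apply: ereal_inf_lbound; exists (dirac_moments (2 * r) v); first exact: dirac_feasible.
by rewrite riesz_dirac// fv.
Qed.

(** One certificate for [f - a] serves both lower bounds: it makes [a] admissible for [lb], and
    evaluated at a feasible [y] it bounds [mlb]. *)
Lemma hierarchy_rate : exists C d, forall r, (d <= r)%N ->
  [/\ (mlb rho f r <= fmin%:E)%E, ((fmin - C / r%:R ^+ 2)%:E <= mlb rho f r)%E,
      (lb rho f r <= fmin%:E)%E & ((fmin - C / r%:R ^+ 2)%:E <= lb rho f r)%E].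
Proof.
have [|C [d [C0 CE]]] := @sphere_sos_rate K n n_gt0 rho rho_gt0 (f - fmin%:MP).
  by move=> v vS; rewrite mevalB mevalC subr_ge0 fmin_le.
(* Large enough that [r > 0], that the error certificates fit, and that no term of [f] is truncated
   by [riesz]. *)
exists C, (d + msize f).+1 => r dr.
have [r0 [dr' fr]] : (0 < r)%N /\ (d <= r)%N /\ (msize f <= (2 * r).+1)%N.
  by move: (mmeasure _ _) dr => k; lia.
set a := fmin - C / r%:R ^+ 2.
have fa : f - fmin%:MP + (C / r%:R ^+ 2)%:MP = f - a%:MP.
  by rewrite /a mpolyCB; ring.
have sosa : sphere_sos rho r (f - a%:MP) by rewrite -fa; exact: CE.
have far : (msize (f - a%:MP) <= (2 * r).+1)%N.
  by apply: msizeD_leq => //; rewrite msizeN msizeC; case: (_ != 0).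
have [s [t [sr tr fE]]] := sphere_sos_certificate rho_gt0 r0 far sosa.
split; [exact: mlb_le_fmin| |exact: lb_le_fmin|].
  apply: le_ereal_inf_tmp => _ [y yf <-]; rewrite lee_fin -subr_ge0.
  have := riesz_certificate_ge0 r0 yf sr tr fE.
  by rewrite linearB /= rieszC; have [-> _ _] := yf; rewrite mulr1.
by apply: ereal_sup_ubound; exists a => //; exact: certificate_qmodule fE.
Qed.

End Bounds.

(** [fine] sends infinite values to 0, so an estimate on it is meaningful only together with
    finiteness. *)
Lemma fin_numE_between (K : realType) (x : \bar K) (a b : K) :
  (a%:E <= x)%E -> (x <= b%:E)%E -> x \is a fin_num /\ `|b - fine x| <= b - a.
Proof.
case: x => [x| |]; rewrite ?lee_fin// => ax xb; split=> //=.
by rewrite ger0_norm; lra.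
Qed.

Theorem corollary4p16 (K : realType) (n : nat) (n_gt0 : (0 < n)%N)
    (rho : K) (rho_gt0 : 0 < rho) (f : {mpoly K[n]})
    (fmin : K) (fminP : is_minimum (peval f @` sphere rho) fmin) :
  (\forall r \near \oo,
     mlb rho f r \is a fin_num /\ lb rho f r \is a fin_num) /\
  (fun r : nat => fmin - fine (mlb rho f r)) =O_\oo
    (fun r : nat => r%:R ^- 2 : K) /\
  (fun r : nat => fmin - fine (lb rho f r)) =O_\oo
    (fun r : nat => r%:R ^- 2 : K).
Proof.
have [C [d CE]] := hierarchy_rate n_gt0 rho_gt0 fminP.
(* The constant [|C| + 1] is positive even if [C = 0], as the characterisation of [O] demands. *)
have bound r : (d <= r)%N ->
    [/\ mlb rho f r \is a fin_num, lb rho f r \is a fin_num,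
        `|fmin - fine (mlb rho f r)| <= (`|C| + 1) * `|r%:R ^- 2| &
        `|fmin - fine (lb rho f r)| <= (`|C| + 1) * `|r%:R ^- 2|].
  move=> /CE[mlb_ub mlb_lb lb_ub lb_lb].
  have [mlb_fin mlbC] := fin_numE_between mlb_lb mlb_ub.
  have [lb_fin lbC] := fin_numE_between lb_lb lb_ub.
  have le_rate : fmin - (fmin - C / r%:R ^+ 2) <= (`|C| + 1) * `|r%:R ^- 2|.
    rewrite opprB addrC subrK mulrDl -normrM (le_trans (ler_norm _))//.
    by rewrite lerDl mul1r.
  by split=> //; [apply: le_trans mlbC _|apply: le_trans lbC _].
have C1 : 0 < `|C| + 1 by rewrite ltr_wpDl.
split; first by near=> r; have [] := bound r; first by near: r; exists d.
split; apply/eqO_exP; exists (`|C| + 1) => //.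
  by near=> r; have [] := bound r; first by near: r; exists d.
by near=> r; have [] := bound r; first by near: r; exists d.
Unshelve. all: by end_near.
Qed.
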